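(* For all integers $d \geq 5$, $\dim \mathcal{S}(d,6) = \binom{d+2}{2}-4$.
   Context: Let $k$ be an algebraically closed field and $S = k[x_0,x_1,x_2]$, with $\mathbb{P}S_d$ the projective space of plane curves of degree $d$. For $l \geq 2$, let $\mathcal{D}_l \subseteq (\check{\mathbb{P}}^2)^l$ be the quasi-projective variety of $l$-tuples of distinct lines in $\mathbb{P}^2$ no three of which pass through a common point; the star configuration $\mathbb{X}(l)$ of such a tuple is the set of its $\binom{l}{2}$ pairwise intersection points. $\mathcal{S}(d,l)\subseteq \mathbb{P}S_d$ denotes the set of degree-$d$ plane curves containing the star configuration of some tuple in $\mathcal{D}_l$ (the image of the incidence correspondence $\{(\mathcal{C},(\ell_i)) : \mathcal{C}\supseteq \mathbb{X}(l)\}$ under projection to $\mathbb{P}S_d$), and its dimension is that of its Zariski closure. *)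

(* Defs.v *)
From HB Require Import structures.
From mathcomp Require Import all_boot all_order all_algebra.
From mathcomp Require Import mpoly.
Set Implicit Arguments. Unset Strict Implicit. Unset Printing Implicit Defensive.
Import GRing.Theory.
Local Open Scope ring_scope.

(* ---------- Projective space P^(n-1) over k and its Zariski topology ----------
   A point of P^(n-1) is represented by a nonzero vector v : 'I_n -> k
   (all nonzero scalar multiples represent the same point; every set considered
   below is automatically stable under scaling, being defined by homogeneous
   conditions).  A set of points is a predicate on vectors. *)

Definition pset (k : closedFieldType) (n : nat) := ('I_n -> k) -> Prop.

Definition nzvec (k : closedFieldType) n (v : 'I_n -> k) := exists i, v i != 0.

Definition homogp (k : closedFieldType) n (f : {mpoly k[n]}) :=
  exists e, f \is e.-homog.

Definition zero_locus (k : closedFieldType) n (F : {mpoly k[n]} -> Prop) : pset k n :=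
  fun v => nzvec v /\ forall f, F f -> f.@[v] = 0.

Definition zclosed (k : closedFieldType) n (Z : pset k n) :=
  exists F : {mpoly k[n]} -> Prop,
    (forall f, F f -> homogp f) /\ (forall v, Z v <-> zero_locus F v).

Definition zclosure (k : closedFieldType) n (S : pset k n) : pset k n :=
  zero_locus (fun f => homogp f /\ forall v, S v -> f.@[v] = 0).

Definition psubset (k : closedFieldType) n (A B : pset k n) := forall v, A v -> B v.

Definition pproper (k : closedFieldType) n (A B : pset k n) :=
  psubset A B /\ exists v, B v /\ ~ A v.

Definition zirred (k : closedFieldType) n (Z : pset k n) :=
  [/\ zclosed Z, exists v, Z v &
      forall Z1 Z2 : pset k n, zclosed Z1 -> zclosed Z2 ->
        (forall v, Z v <-> Z1 v \/ Z2 v) -> psubset Z Z1 \/ psubset Z Z2].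

Definition has_chain (k : closedFieldType) n (W : pset k n) (m : nat) :=
  exists Z : nat -> pset k n,
    (forall i, (i <= m)%N -> zirred (Z i) /\ psubset (Z i) W) /\
    (forall i, (i < m)%N -> pproper (Z i) (Z i.+1)).

Definition pdim (k : closedFieldType) n (S : pset k n) (e : nat) :=
  has_chain (zclosure S) e /\ ~ has_chain (zclosure S) e.+1.

Definition dot3 (k : closedFieldType) (a x : 'I_3 -> k) := \sum_(i < 3) a i * x i.

Definition on_line (k : closedFieldType) (a x : 'I_3 -> k) := dot3 a x = 0.

Definition same_line (k : closedFieldType) (a b : 'I_3 -> k) :=
  forall x, nzvec x -> (on_line a x <-> on_line b x).

Definition in_D (k : closedFieldType) (l : nat) (L : 'I_l -> ('I_3 -> k)) :=
  [/\ forall i, nzvec (L i),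
      forall i j, i != j -> ~ same_line (L i) (L j) &
      forall i j m, i != j -> j != m -> i != m ->
        ~ (exists x, [/\ nzvec x, on_line (L i) x, on_line (L j) x & on_line (L m) x])].

Definition star_pt (k : closedFieldType) l (L : 'I_l -> ('I_3 -> k)) (x : 'I_3 -> k) :=
  nzvec x /\ exists i j, i != j /\ on_line (L i) x /\ on_line (L j) x.

Definition contains_star (k : closedFieldType) l (p : {mpoly k[3]}) (L : 'I_l -> ('I_3 -> k)) :=
  forall x, star_pt L x -> p.@[x] = 0.

(* ---------- The projective space PS_d of plane curves of degree d ----------
   Coordinates on S_d are indexed by the monomials of degree d in x0,x1,x2. *)
Definition mon (d : nat) := {m : 'X_{1..3 < d.+1} | mdeg (bmnm m) == d}.

Definition coords (k : closedFieldType) d (p : {mpoly k[3]}) : 'I_#|{: mon d}| -> k :=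
  fun j => p@_(bmnm (val (@enum_val (mon d) predT j))).

Definition Sdl (k : closedFieldType) (d l : nat) : pset k #|{: mon d}| :=
  fun v => exists (p : {mpoly k[3]}) (L : 'I_l -> ('I_3 -> k)),
    [/\ p != 0, p \is d.-homog, in_D L, contains_star p L &
        forall j, v j = @coords k d p j].

(* Main.v *)
Require Import Defs.
From HB Require Import structures.
From mathcomp Require Import all_boot all_order all_algebra.
From mathcomp Require Import mpoly.
From mathcomp Require Import ring zify.
From Stdlib Require Import Classical.
Set Implicit Arguments. Unset Strict Implicit. Unset Printing Implicit Defensive.
Import GRing.Theory.
Local Open Scope ring_scope.

(** Write [l_i] for the six lines and [N] for the number of monomials of degree [d].  The
    forms of degree [d >= 5] vanishing on the star configuration are exactly
    [f = sum_i g_i prod_(j <> i) l_j] with [deg g_i = d - 5]: the 15 products of four lines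
    form a basis of the quartics, dual to the 15 vertices, and one multiplies up from
    there.  They form a space of dimension [N - 15], so after normalising the lines and
    one coefficient, S(d,6) is covered by finitely many charts with
    [12 + (N - 16) = N - 4] parameters.

    Upper bound: a chain [Z_0 < ... < Z_m] of irreducible closed sets yields [m + 1] forms
    of equal degree satisfying no homogeneous relation on [Z_m], whereas [n + 2]
    polynomials in [n] variables always satisfy a homogeneous relation.

    Lower bound: it suffices to move along a family through one point whose leading terms
    span a space of codimension three.  Dually, a functional killing these terms is a
    combination of evaluations at the vertices whose weights [W_p] balance on every line,
    [sum_(p on l) W_p p = 0].  For the triangle of coordinates and the lines
    [(1, t, t^2)], [t = 1, s, s^2], with no weight on the vertices of the last three
    lines, this forces [2 W = 0] on the triangle, hence [W = 0] unless the characteristic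
    is 2.  In characteristic 2 translating all the lines by a common linear form [m] does
    not change [sum_i prod_(j <> i) l_j] to first order; its second order effect,
    [m^2 e_3(l)], supplies three more directions, and [s^3 = s + 1] makes them
    independent. *)

(** * Polynomials in several variables *)

Lemma meval_muni (R : comNzRingType) n (p : {mpoly R[n.+1]}) (v : 'I_n.+1 -> R) :
  p.@[v] =
  (map_poly (meval (fun i => v (widen_ord (leqnSn n) i))) (muni p)).[v ord_max].
Proof.
rewrite muniE rmorph_sum /= horner_sum mevalE; apply: eq_bigr => m _.
rewrite map_polyZ /= map_polyXn hornerZ hornerXn mevalZ mevalX.
rewrite big_ord_recr /= -mulrA; congr (_ * (_ * _)).
apply: eq_bigr => i _; congr (_ ^+ _).
by rewrite /fun_of_multinom /= tnth_mktuple.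
Qed.

(** An exponent vector is recovered from its last entry and its truncation [low], so the coefficient
    at [m0] reappears in [muni p] without cancellation. *)
Lemma muni_neq0 (R : comNzRingType) n (p : {mpoly R[n.+1]}) :
  p != 0 -> muni p != 0.
Proof.
pose low (m : 'X_{1..n.+1}) :=
  [multinom [tuple m (widen_ord (leqnSn n) i) | i < n]].
rewrite -msupp_eq0; case E: (msupp p) => [//|m0 s] _.
have m0p : m0 \in msupp p by rewrite E mem_head.
apply/eqP => p0; move: (m0p); rewrite mcoeff_msupp => /eqP; apply.
have: ((muni p)`_(m0 ord_max))@_(low m0) = 0 by rewrite p0 coef0 mcoeff0.
rewrite muniE coef_sum raddf_sum /= (bigD1_seq m0) ?msupp_uniq //=.
rewrite coefZ coefXn eqxx mulr1 mcoeffZ mcoeffX eqxx mulr1 big1 ?addr0 // => m nm.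
rewrite coefZ coefXn; case: eqP => [e|_]; last by rewrite mulr0 mcoeff0.
rewrite mulr1 mcoeffZ mcoeffX; case: eqP => [e'|_]; last by rewrite mulr0.
case/eqP: nm; apply/mnmP => i; case: (unliftP ord_max i) => [j ->|-> //].
have /mnmP/(_ j) : low m = low m0 by [].
rewrite /low /fun_of_multinom /= !tnth_mktuple /fun_of_multinom.
by rewrite (_ : widen_ord _ _ = lift ord_max j) //; apply/val_inj; rewrite /= /bump leqNgt ltn_ord.
Qed.

(** Choose values of the other variables that keep the leading coefficient in the last variable
    nonzero, then avoid the finitely many roots of the resulting univariate polynomial; the field is
    infinite. *)
Lemma mpoly_nonroot (k : closedFieldType) n (p : {mpoly k[n]}) :
  p != 0 -> exists v, p.@[v] != 0.
Proof.
elim: n p => [|n IH] p pn0.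
  exists (fun _ => 0); move: pn0; rewrite (nvar0_mpolyC p) mpolyC_eq0.
  by rewrite mevalC.
have /muni_neq0 := pn0; rewrite -lead_coef_eq0 lead_coefE => /IH [v vn].
have : map_poly (meval v) (muni p) != 0.
  by apply/eqP => /polyP/(_ (size (muni p)).-1); rewrite coef_map coef0 /=; apply/eqP.
case/closed_nonrootP => x xr.
exists (fun i => if unlift ord_max i is Some j then v j else x).
rewrite meval_muni unlift_none.
rewrite (_ : map_poly _ _ = map_poly (meval v) (muni p)) //.
apply/polyP => i; rewrite !coef_map /=; apply: meval_eq => j.
by rewrite (_ : widen_ord _ _ = lift ord_max j) ?liftK //; apply/val_inj; rewrite /= /bump leqNgt ltn_ord.
Qed.

Lemma mpoly_eq0_meval (k : closedFieldType) n (p : {mpoly k[n]}) :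
  (forall v, p.@[v] = 0) -> p = 0.
Proof.
move=> p0; apply/eqP; apply/negPn/negP => /mpoly_nonroot [v].
by rewrite p0 eqxx.
Qed.

Lemma meval_homog_scale (R : comNzRingType) n (p : {mpoly R[n]}) e c v :
  p \is e.-homog -> p.@[fun i => c * v i] = c ^+ e * p.@[v].
Proof.
move=> /dhomogP hp; rewrite !mevalE mulr_sumr big_seq [RHS]big_seq.
apply: eq_bigr => m /hp /= <-; rewrite mdegE.
rewrite (eq_bigr (fun i => c ^+ m i * v i ^+ m i)) => [|i _]; last exact: exprMn.
by rewrite big_split prodrXr /= mulrCA.
Qed.

Lemma dhomog_prodl (R : comNzRingType) n (I : Type) (r : seq I) (P : pred I)
    (F : I -> {mpoly R[n]}) (e : I -> nat) :
  (forall i, P i -> F i \is (e i).-homog) ->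
  \prod_(i <- r | P i) F i \is (\sum_(i <- r | P i) e i)%N.-homog.
Proof.
move=> hF; apply: (big_rec2 (fun q s => q \is s.-homog)).
  exact: dhomog1.
by move=> i q s Pi; apply: dhomogM; apply: hF.
Qed.

Lemma dhomog_suml (R : comNzRingType) n (I : Type) (r : seq I) (P : pred I)
    (F : I -> {mpoly R[n]}) (e : nat) :
  (forall i, P i -> F i \is e.-homog) -> \sum_(i <- r | P i) F i \is e.-homog.
Proof.
move=> hF; elim/big_rec: _ => [|i q Pi]; first exact: dhomog0.
by apply: dhomogD; apply: hF.
Qed.

Lemma dhomog_comp (R : comNzRingType) n l (P : {mpoly R[n]}) D e
    (f : n.-tuple {mpoly R[l]}) :
  P \is D.-homog -> (forall i, tnth f i \is e.-homog) -> P \mPo f \is (e * D)%N.-homog.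
Proof.
move=> /dhomogP hP hf; rewrite comp_mpolyEX big_seq.
apply: dhomog_suml => m /hP /= <-.
apply: dhomogZ; rewrite comp_mpolyX mdegE big_distrr /=.
by apply: dhomog_prodl => i _; apply: dhomogMn.
Qed.

Lemma msize_prod_le (R : idomainType) n (I : Type) (r : seq I) (P : pred I)
    (F : I -> {mpoly R[n]}) (e : I -> nat) :
  (forall i, P i -> (msize (F i) <= (e i).+1)%N) ->
  (msize (\prod_(i <- r | P i) F i) <= (\sum_(i <- r | P i) e i).+1)%N.
Proof.
move=> hF; apply: (big_rec2 (fun q s => (msize q <= s.+1)%N)).
  by rewrite msize1.
move=> i q s Pi hq; have h := hF _ Pi.
case: (eqVneq (F i) 0) => [->|n1]; first by rewrite mul0r msize0.
case: (eqVneq q 0) => [->|n2]; first by rewrite mulr0 msize0.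
by rewrite msizeM // -subn1 leq_subLR add1n (leq_trans (leq_add h hq)) // addnS addSn.
Qed.

(* The monomials of degree [(n+1)D] whose first exponents are at most [D] outnumber
   the monomials of bounded degree in [n] variables as soon as [D] is large. *)
Lemma homog_dependency (k : fieldType) n (g : n.+2.-tuple {mpoly k[n]}) :
  exists (D : nat) (P : {mpoly k[n.+2]}), [/\ P != 0, P \is D.-homog & P \mPo g = 0].
Proof.
pose C := (\max_(i < n.+2) msize (tnth g i)).+1.
have hC i : (msize (tnth g i) <= C.+1)%N.
  apply: leq_trans (_ : _ <= \max_(i < n.+2) msize (tnth g i))%N _; last by rewrite /C; lia.
  exact: (leq_bigmax i).
(* [C] is positive and bounds all degrees, so the composites have degree at most [B]. The choice
   [D = K^n] makes the count work: [(B+1)^n <= (K(D+1))^n = D (D+1)^n < (D+1)^(n+1)]. *)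
pose K := (C * n.+1)%N; pose D := (K ^ n)%N.
pose B := (K * D)%N.
pose E := {ffun 'I_n.+1 -> 'I_D.+1}.
pose tot (a : E) := (\sum_i a i)%N.
have tot_le a : (tot a <= n.+1 * D)%N.
  rewrite -[X in (_ <= X * _)%N]card_ord -sum_nat_const; apply: leq_sum => i _.
  by rewrite -ltnS.
(* The last exponent tops the free ones up to total degree [(n+1) D]. *)
pose M (a : E) : 'X_{1..n.+2} :=
  [multinom (if unlift ord_max i is Some j then a j : nat else n.+1 * D - tot a)%N | i < n.+2].
have ME a j : M a (lift ord_max j) = a j by rewrite mnmE liftK.
have Mmax a : M a ord_max = (n.+1 * D - tot a)%N by rewrite mnmE unlift_none.
have Mdeg a : mdeg (M a) = (n.+1 * D)%N.
  rewrite mdegE (bigD1_ord ord_max) //= Mmax.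
  by rewrite (eq_bigr (fun j => a j : nat)) ?subnK ?tot_le // => j _; rewrite ME.
have Minj : injective M.
  move=> a b /mnmP eqM; apply/ffunP => j; apply/val_inj.
  by have := eqM (lift ord_max j); rewrite !ME.
pose T := 'X_{1..n < B.+1}.
have cardT : (#|{: T}| <= B.+1 ^ n)%N.
  have -> : (B.+1 ^ n)%N = #|{: {ffun 'I_n -> 'I_B.+1}}| by rewrite card_ffun !card_ord.
  pose F (m : T) : {ffun 'I_n -> 'I_B.+1} := [ffun i => inord (bmnm m i)].
  apply: (@leq_card _ _ F) => m1 m2 /ffunP eqF; apply/val_inj/mnmP => i.
  have := congr1 val (eqF i); rewrite !ffunE /=.
  have lt (m : T) : (bmnm m i < B.+1)%N.
    apply: leq_ltn_trans (bmdeg m); rewrite mdegE.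
    by rewrite (bigD1 i) //= leq_addr.
  by rewrite !inordK ?lt.
have comp_size a : (msize ('X_[M a] \mPo g) <= B.+1)%N.
  rewrite comp_mpolyX.
  have h := @msize_prod_le _ _ _ _ _ (fun i => tnth g i ^+ M a i) (fun i => (C * M a i)%N) _.
  apply: leq_trans (h _ _ _) _ => [i _|].
    elim: (M a i) => [|q IH]; first by rewrite expr0 msize1.
    rewrite exprS; have [->|n1] := eqVneq (tnth g i) 0; first by rewrite mul0r msize0.
    have [->|n2] := eqVneq (tnth g i ^+ q) 0; first by rewrite mulr0 msize0.
    rewrite msizeM // -subn1 leq_subLR add1n (leq_trans (leq_add (hC i) IH)) //.
    by rewrite mulnS addnS addSn.
  by rewrite ltnS -big_distrr /= -mdegE Mdeg mulnA.
pose A : 'M[k]_(#|{: E}|, #|{: T}|) :=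
  \matrix_(i, j) ('X_[M (enum_val i)] \mPo g)@_(bmnm (enum_val j)).
have ltTE : (#|{: T}| < #|{: E}|)%N.
  apply: leq_ltn_trans cardT _.
  rewrite card_ffun !card_ord.
  have KD : (B.+1 <= K * D.+1)%N by rewrite mulnS /B -add1n leq_add2r muln_gt0.
  case: (posnP n) => [-> /=|n_gt0]; first by rewrite expn0 expn1 ltnS expn_gt0 muln_gt0.
  apply: leq_ltn_trans (_ : (K * D.+1) ^ n < _)%N; first by rewrite leq_exp2r.
  by rewrite expnMn expnSr mulnC ltn_pmul2l // expn_gt0.
(* There are more rows than columns; a nonzero row killed by [A] supplies the coefficients of
   [P]. *)
have [u un0 uA] : exists2 u : 'rV_#|{: E}|, u != 0 & u *m A = 0.
  have : kermx A != 0.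
    rewrite kermx_eq0 /row_free neq_ltn; apply/orP; left.
    exact: leq_ltn_trans (rank_leq_col A) ltTE.
  by case/rowV0Pn => u /sub_kermxP uA un0; exists u.
exists (n.+1 * D)%N, (\sum_(i < #|{: E}|) u 0 i *: 'X_[M (enum_val i)]); split.
- case/rV0Pn: un0 => i0 ui0; apply: contraNneq ui0 => P0.
  have /(congr1 (mcoeff (M (enum_val i0)))) := P0.
  rewrite mcoeff0 raddf_sum /= (bigD1 i0) //= mcoeffZ mcoeffX eqxx mulr1.
  rewrite big1 ?addr0 => [->//|i ni].
  rewrite mcoeffZ mcoeffX; case: eqP => [/Minj/enum_val_inj e|_]; last by rewrite mulr0.
  by rewrite e eqxx in ni.
- by apply: dhomog_suml => i _; apply: dhomogZ; rewrite dhomogX; apply/eqP/Mdeg.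
rewrite raddf_sum /=; apply/mpolyP => m; rewrite mcoeff0 raddf_sum /=.
have [lt_m|le_m] := ltnP (mdeg m) B.+1; last first.
  apply: big1 => i _; rewrite linearZ /= mcoeffZ memN_msupp_eq0 ?mulr0 //.
  by rewrite msize_mdeg_ge // (leq_trans (comp_size _)).
have /matrixP/(_ 0 (enum_rank (BMultinom lt_m))) := uA.
rewrite !mxE => uA0; rewrite -[RHS]uA0; apply: eq_bigr => i _.
by rewrite linearZ /= mcoeffZ !mxE enum_rankK.
Qed.

(** * Chains of irreducible closed sets *)

Section ProjectiveSets.
Variables (k : closedFieldType) (n : nat).
Implicit Types (Z S : pset k n) (f g : {mpoly k[n]}).

Definition vanishes f Z := forall v, Z v -> f.@[v] = 0.

Lemma zclosed_nzvec Z v : zclosed Z -> Z v -> nzvec v.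
Proof. by case=> F [_ hZ] /hZ []. Qed.

Lemma zclosedI Z f : zclosed Z -> homogp f -> zclosed (fun v => Z v /\ f.@[v] = 0).
Proof.
case=> F [hF hZ] hf; exists (fun g => F g \/ g = f); split=> [g [/hF //|->//]|v].
split=> [[/hZ [nv Fv] fv]|[nv Fv]]; first by split=> // g [/Fv //|->].
by split; [apply/hZ; split=> // g Fg; apply: Fv; left | apply: Fv; right].
Qed.

Lemma zclosed_zclosure S : zclosed (zclosure S).
Proof. by exists (fun f => homogp f /\ vanishes f S); split=> // f []. Qed.

Lemma zirred_vanishesM Z f g : zirred Z -> homogp f -> homogp g ->
  vanishes (f * g) Z -> vanishes f Z \/ vanishes g Z.
Proof.
case=> [cZ _ irr] hf hg fg0.
have [||v|h|h] := irr (fun v => Z v /\ f.@[v] = 0) (fun v => Z v /\ g.@[v] = 0).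
- exact: zclosedI.
- exact: zclosedI.
- split=> [Zv|[[]|[]] //].
  have /eqP := fg0 _ Zv; rewrite mevalM mulf_eq0.
  by case/orP=> /eqP e; [left|right].
- by left=> v /h [].
- by right=> v /h [].
Qed.

Lemma zirred_vanishesX Z f r : zirred Z -> homogp f ->
  vanishes (f ^+ r) Z -> vanishes f Z.
Proof.
move=> irrZ hf; elim: r => [|r IH]; last first.
  rewrite exprS => /zirred_vanishesM [] //.
  by case: hf => e hf; exists (e * r)%N; apply: dhomogMn.
case: irrZ => _ [v Zv] _ /(_ v Zv) /eqP.
by rewrite expr0 meval1 oner_eq0.
Qed.

Lemma homog0_meval f v w : f \is 0.-homog -> f.@[v] = f.@[w].
Proof.
move=> hf; have h u : f.@[u] = f.@[fun=> 0].
  have := meval_homog_scale 0 u hf; rewrite expr0 mul1r => <-.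
  by apply: meval_eq => i; rewrite mul0r.
by rewrite (h v) (h w).
Qed.

Lemma homog_meval0 f e v : f \is e.-homog -> (0 < e)%N -> v =1 (fun=> 0) -> f.@[v] = 0.
Proof.
move=> hf e0 v0; have := meval_homog_scale 0 v hf.
rewrite expr0n eqn0Ngt e0 mul0r => <-.
by apply: meval_eq => i; rewrite v0 mulr0.
Qed.

(** A proper inclusion gives a form vanishing on the smaller set but not on the larger; a coordinate
    serves for [Z 0]. Taking powers equalises the degrees, and by irreducibility a power still does
    not vanish identically. *)
Lemma separating_forms (Z : nat -> pset k n) m :
  (forall i, (i <= m)%N -> zirred (Z i)) ->
  (forall i, (i < m)%N -> pproper (Z i) (Z i.+1)) ->
  exists (f : 'I_m.+1 -> {mpoly k[n]}) (e : nat), [/\ (0 < e)%N,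
    forall i, f i \is e.-homog,
    forall i, ~ vanishes (f i) (Z i) &
    forall (i : 'I_m.+1) (j : nat), i = j.+1 :> nat -> vanishes (f i) (Z j)].
Proof.
move=> irr prop.
have step (i : 'I_m.+1) : exists fe : {mpoly k[n]} * nat, [/\ (0 < fe.2)%N,
    fe.1 \is (fe.2).-homog, ~ vanishes fe.1 (Z i) &
    forall j : nat, i = j.+1 :> nat -> vanishes fe.1 (Z j)].
  case: i => [[|i] lti] /=.
    have [cZ [v Zv] _] := irr 0%N (leq0n m).
    have [j vj] := zclosed_nzvec cZ Zv.
    exists ('X_j, 1%N); split=> //=; first by rewrite dhomogX; apply/eqP/mdeg1.
    by move=> /(_ v Zv) /eqP; rewrite mevalXU (negPf vj).
  have [_ [v [Zv nZv]]] := prop i lti.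
  have [[F [hF hZ]] [w Zw] _] := irr i (ltnW lti).
  have [cZ' _ _] := irr i.+1 lti.
  have [f [Ff fv]] : exists f, F f /\ f.@[v] <> 0.
    apply: NNPP => h; apply/nZv/hZ; split; first exact: zclosed_nzvec Zv.
    by move=> f Ff; apply: NNPP => fv; apply: h; exists f.
  have fZ : vanishes f (Z i) by move=> u /hZ [_ /(_ f Ff)].
  have [e hf] := hF _ Ff.
  exists (f, e); split=> //=; last by move=> j [<-].
    rewrite lt0n; apply/eqP => e0; rewrite e0 in hf.
    by apply: fv; rewrite (homog0_meval _ w hf) fZ.
  by move=> /(_ v Zv).
have [fe hfe] := fin_all_exists step.
(* The exponent is the product of the other degrees, so the common degree is the product of all of
   them. *)
pose E (i : 'I_m.+1) := (\prod_(j | j != i) (fe j).2)%N.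
have E0 i : (0 < E i)%N.
  by apply: prodn_cond_gt0 => j _; case: (hfe j).
exists (fun i => (fe i).1 ^+ E i), (\prod_j (fe j).2)%N; split.
- by apply: prodn_cond_gt0 => j _; case: (hfe j).
- by move=> i; rewrite (bigD1 i) //=; apply: dhomogMn; case: (hfe i).
- move=> i; have [_ hom nv _] := hfe i.
  move=> /zirred_vanishesX h; apply/nv/h; last by exists (fe i).2.
  by apply: irr; rewrite -ltnS.
move=> i j eij v Zv; have [_ _ _ h] := hfe i.
by rewrite rmorphXn /= (h j eij v Zv) expr0n eqn0Ngt E0.
Qed.

(* Descending induction on the number of variables occurring in [P]: after dividing [P]
   by a power of its last variable and setting that variable to zero, the value of [P]
   on the next smaller member of the chain is governed by a polynomial in fewer variables. *)
Lemma separating_forms_independent (Z : nat -> pset k n) m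
    (f : m.+1.-tuple {mpoly k[n]}) (e D : nat) (P : {mpoly k[m.+1]}) :
  (forall i, (i <= m)%N -> zirred (Z i)) ->
  (forall i, (i < m)%N -> pproper (Z i) (Z i.+1)) -> (0 < e)%N ->
  (forall i, tnth f i \is e.-homog) ->
  (forall i, ~ vanishes (tnth f i) (Z i)) ->
  (forall (i : 'I_m.+1) (j : nat), i = j.+1 :> nat -> vanishes (tnth f i) (Z j)) ->
  P != 0 -> P \is D.-homog -> ~ vanishes (P \mPo f) (Z m).
Proof.
move=> irr prop e0 hf fZ fZ' P0 hP.
(* [Z'] shifts the chain by one and starts it with the origin: polynomials in the first [l]
   variables are tested on [Z' l], and [l = 0] is the case of constants. *)
pose Z' l : pset k n := if l is j.+1 then Z j else fun v => v =1 fun=> 0.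
suff claim l : (l <= m.+1)%N -> forall D (P : {mpoly k[m.+1]}), P != 0 -> P \is D.-homog ->
    (forall a, a \in msupp P -> forall i : 'I_m.+1, (l <= i)%N -> a i = 0%N) ->
    ~ vanishes (P \mPo f) (Z' l).
  apply: (claim m.+1 (leqnn _) D P P0 hP) => a _ i.
  by rewrite leqNgt ltn_ord.
elim: l => [_|l IH lem] {}D {}P {}P0 {}hP suppP.
  move=> /(_ (fun=> 0) (fun=> erefl)) /eqP.
  have -> : P = (P@_0)%:MP.
    apply/mpolyP => a; rewrite mcoeffC; case: eqP => [->|/eqP na]; first by rewrite mulr1.
    rewrite mulr0; apply: memN_msupp_eq0; apply: contra na => /suppP ha.
    by apply/eqP/mnmP => i; rewrite ha // mnm0E.
  rewrite comp_mpolyC mevalC => /eqP c0; move/eqP: P0; apply; apply/mpolyP => a.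
  rewrite mcoeff0; case: (eqVneq a 0%MM) => [->//|na].
  apply: memN_msupp_eq0; apply: contra na => /suppP ha.
  by apply/eqP/mnmP => i; rewrite ha // mnm0E.
have [L EL] : exists L : 'I_m.+1, L = l :> nat by exists (Ordinal lem).
have [r [a0 a0P a0r] rmin] : exists2 r, (exists2 a, a \in msupp P & a L = r) &
    forall a, a \in msupp P -> (r <= a L)%N.
  have ex : exists r, has (fun a : 'X_{1..m.+1} => a L == r) (msupp P).
    case E: (msupp P) (msupp_eq0 P) => [|a s] h; first by rewrite eqxx (negPf P0) in h.
    by exists (a L); apply/hasP; exists a; rewrite ?mem_head.
  case: (ex_minnP ex) => r /hasP [a aP /eqP ar] rmin; exists r; first by exists a.
  by move=> b bP; apply: rmin; apply/hasP; exists b.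
pose dv (a : 'X_{1..m.+1}) := (a - U_(L) *+ r)%MM.
have dvE a : a \in msupp P -> a = (U_(L) *+ r + dv a)%MM.
  move=> /rmin ra; apply/mnmP => i; rewrite mnmDE mnmBE mulmnE mnm1E.
  by case: eqP => [<-|_]; rewrite ?mul1n ?subnKC ?mul0n ?add0n ?subn0.
(* [P] is [X_L^r Q], and [P1] is [Q] at [X_L = 0], a polynomial in the first [l] variables. *)
pose Q := \sum_(a <- msupp P) P@_a *: 'X_[dv a].
pose P1 := \sum_(a <- msupp P | a L == r) P@_a *: 'X_[dv a].
have PQ : P = 'X_L ^+ r * Q.
  rewrite {1}[P]mpolyE mulr_sumr big_seq [RHS]big_seq; apply: eq_bigr => a aP.
  by rewrite -scalerAr mpolyXn -mpolyXD -dvE.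
have deg_dv a : a \in msupp P -> mdeg (dv a) = (D - r)%N.
  move=> aP; have /dhomogP/(_ a aP) /= := hP; rewrite {1}(dvE a aP).
  by rewrite mdegD mdegMn mdeg1 mul1n => <-; rewrite addKn.
have hQ : Q \is (D - r)%N.-homog.
  rewrite /Q big_seq; apply: dhomog_suml => a aP; apply: dhomogZ.
  by rewrite dhomogX; apply/eqP/deg_dv.
have hP1 : P1 \is (D - r)%N.-homog.
  rewrite /P1 big_seq_cond; apply: dhomog_suml => a /andP [aP _]; apply: dhomogZ.
  by rewrite dhomogX; apply/eqP/deg_dv.
have P10 : P1 != 0.
  apply/eqP => /mpolyP/(_ (dv a0)); rewrite mcoeff0 raddf_sum /=.
  rewrite big_mkcond /= (bigD1_seq a0) ?msupp_uniq //= a0r eqxx.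
  rewrite mcoeffZ mcoeffX eqxx mulr1 big_seq_cond big1 ?addr0 => [/eqP|a].
    by apply/negP; rewrite -mcoeff_msupp.
  case/andP=> aP na; case: eqP => // ar; rewrite mcoeffZ mcoeffX.
  case: eqP => [eq_dv|_]; last by rewrite mulr0.
  by case/eqP: na; rewrite (dvE a aP) (dvE a0 a0P) eq_dv.
have suppP1 a : a \in msupp P1 -> forall i : 'I_m.+1, (l <= i)%N -> a i = 0%N.
  move=> aP1 i li; apply/eqP; apply/negPn/negP => ai.
  move: aP1; rewrite mcoeff_msupp => /eqP; apply.
  rewrite raddf_sum /= big_seq_cond big1 // => b /andP [bP /eqP br].
  rewrite mcoeffZ mcoeffX; case: eqP => [eba|_]; last by rewrite mulr0.
  case/eqP: ai; rewrite -eba mnmBE mulmnE mnm1E.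
  have [<-|nL] := eqVneq L i; first by rewrite br mul1n subnn.
  rewrite mul0n subn0 (suppP b bP) // ltn_neqAle li andbT.
  by apply: contra nL => /eqP e'; apply/eqP/val_inj; rewrite /= EL.
have QP1 y : y L = 0 -> Q.@[y] = P1.@[y].
  move=> yL; rewrite /Q /P1 !raddf_sum /= [RHS]big_mkcond /= big_seq [RHS]big_seq.
  apply: eq_bigr => a aP; case: eqP => // ar.
  rewrite mevalZ mevalX (bigD1 L) //= yL expr0n mnmBE mulmnE mnm1E eqxx mul1n.
  have := rmin a aP; rewrite leq_eqVlt eq_sym; case/orP=> [/eqP //|ra].
  by rewrite eqn0Ngt subn_gt0 ra mul0r mulr0.
have irrl : zirred (Z l) by apply: irr; rewrite -ltnS.
rewrite PQ rmorphM rmorphXn /= comp_mpolyXU -tnth_nth => /zirred_vanishesM.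
case=> //.
- by exists (e * r)%N; apply: dhomogMn.
- by exists (e * (D - r))%N; apply: dhomog_comp.
- by move=> /zirred_vanishesX h; apply: (fZ L); rewrite EL; apply: h => //; exists e.
move=> Q0; apply: (IH (ltnW lem) _ P1 P10 hP1 suppP1) => v.
have Z'S : (0 < l)%N -> Z' l v -> Z l.-1 v by move=> l0; rewrite -{1}(prednK l0).
have Z'0 : l = 0%N -> Z' l v -> v =1 fun=> 0 by move=> ->.
have hQf := dhomog_comp hQ hf.
(* On [Z' l] the form [f_L] vanishes, so [P1] and [Q] agree there after substitution. For [l = 0]
   the only point is the origin; if the composite has degree 0 it is constant and is compared with a
   point of [Z 0]. *)
have [l0|l0] := posnP l.
  move=> /(Z'0 l0) v0; have fL : (tnth f L).@[v] = 0 by apply: homog_meval0 (hf _) e0 v0.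
  rewrite comp_mpoly_meval -QP1 ?fL // -comp_mpoly_meval.
  have [s0|s0] := posnP (e * (D - r))%N; last by apply: homog_meval0 hQf s0 v0.
  by rewrite s0 in hQf; have [_ [w Zw] _] := irrl; rewrite (homog0_meval _ w hQf) Q0.
move=> /(Z'S l0) Zv; have fL : (tnth f L).@[v] = 0 by apply: fZ' Zv; rewrite EL prednK.
rewrite comp_mpoly_meval -QP1 ?fL // -comp_mpoly_meval; apply: Q0.
have [|sub _] := prop l.-1; first by rewrite prednK.
by rewrite prednK // in sub; apply: sub.
Qed.

End ProjectiveSets.

(** A chain of length [n + 1] gives [n + 2] separating forms, whose pullbacks to a chart with [n]
    parameters satisfy a homogeneous relation. The product of these relations over the charts
    vanishes on [S], against the independence of the forms; homogeneity absorbs the factor [c]. *)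
Lemma no_chain_of_charts (k : closedFieldType) N n (S : pset k N) (X : finType)
    (phi : X -> N.-tuple {mpoly k[n]}) :
  (forall v, S v -> exists x c w, forall j, v j = c * (tnth (phi x) j).@[w]) ->
  ~ has_chain (zclosure S) n.+1.
Proof.
move=> cover [Z [irrZ prop]].
have irr i : (i <= n.+1)%N -> zirred (Z i) by move=> /irrZ [].
have [f [e [e0 hf fZ fZ']]] := separating_forms irr prop.
pose F := [tuple f i | i < n.+2].
have FE i : tnth F i = f i by rewrite tnth_mktuple.
have dep x : exists DP : nat * {mpoly k[n.+2]}, [/\ DP.2 != 0, DP.2 \is (DP.1).-homog &
    (DP.2 \mPo F) \mPo phi x = 0].
  have [D [P [P0 hP PG]]] := homog_dependency [tuple f i \mPo phi x | i < n.+2].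
  exists (D, P); split=> //=; apply: mpoly_eq0_meval => v.
  have := congr1 (meval v) PG; rewrite meval0 !comp_mpoly_meval => <-.
  apply: meval_eq => i; rewrite !tnth_mktuple comp_mpoly_meval; apply: meval_eq => j.
  by [].
have [DP hDP] := fin_all_exists dep.
pose P := \prod_x (DP x).2.
have P0 : P != 0 by apply/prodf_neq0 => x _; case: (hDP x).
have hP : P \is (\sum_x (DP x).1)%N.-homog.
  by apply: dhomog_prodl => x _; case: (hDP x).
have hF i : tnth F i \is e.-homog by rewrite FE.
apply: (separating_forms_independent (f := F) irr prop e0 _ _ _ P0 hP) => //.
- by move=> i; rewrite FE; apply: fZ.
- by move=> i j; rewrite FE; apply: fZ'.
have [_ sub] := irrZ _ (leqnn n.+1); move=> v /sub [_]; apply; split.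
  by eexists; apply: dhomog_comp hP hF.
move=> s /cover [x [c [w sE]]].
rewrite rmorph_prod rmorph_prod /= (bigD1 x) //=.
have [_ hPx Px] := hDP x.
suff -> : ((DP x).2 \mPo F).@[s] = 0 by rewrite mul0r.
rewrite (meval_eq _ sE) (meval_homog_scale _ _ (dhomog_comp hPx hF)).
by rewrite -comp_mpoly_meval Px meval0 mulr0.
Qed.

(** * Chains in the closure of a parametrised family *)

Lemma closed_sqrt (k : closedFieldType) (c : k) : exists x, x ^+ 2 = c.
Proof.
have /closed_rootP [x] : size ('X^2 - c%:P : {poly k}) != 1%N by rewrite size_XnsubC.
by rewrite rootE !hornerE subr_eq0 => /eqP <-; exists x.
Qed.

Lemma poly_eq0_horner (k : closedFieldType) (p : {poly k}) :
  (forall t, p.[t] = 0) -> p = 0.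
Proof.
move=> p0; apply/eqP; apply/negPn/negP => /closed_nonrootP [t].
by rewrite rootE p0 eqxx.
Qed.

(* The part of [P] of least order in the variables other than the first one is what
   survives at [t = 0] after dividing by the largest power of [t]. *)
Lemma lowest_order_term (k : closedFieldType) n (P : {mpoly k[n.+1]}) D :
  P \is D.-homog ->
  (forall v : 'I_n.+1 -> k, v ord0 = 1 -> exists u : 'I_n.+1 -> {poly k},
     (forall b, (u b).[0] = v b) /\
     (forall t, P.@[fun b => t ^+ (2 * (b != ord0)) * (u b).[t]] = 0)) ->
  P = 0.
Proof.
move=> /dhomogP hP hyp; apply/eqP; apply/negPn/negP => P0.
(* [ord a] is the power of [t] that the monomial [a] picks up in the hypothesis. *)
pose ord (a : 'X_{1..n.+1}) := (\sum_(b < n.+1) 2 * (b != ord0) * a b)%N.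
have [r [a0 a0P a0r] rmin] : exists2 r, (exists2 a, a \in msupp P & ord a = r) &
    forall a, a \in msupp P -> (r <= ord a)%N.
  have ex : exists r, has (fun a => ord a == r) (msupp P).
    case E: (msupp P) (msupp_eq0 P) => [|a s] h; first by rewrite eqxx (negPf P0) in h.
    by exists (ord a); apply/hasP; exists a; rewrite ?mem_head.
  case: (ex_minnP ex) => r /hasP [a aP /eqP ar] rmin; exists r; first by exists a.
  by move=> b bP; apply: rmin; apply/hasP; exists b.
pose Pr := \sum_(a <- msupp P | ord a == r) P@_a *: 'X_[a].
have Pr0 : Pr != 0.
  apply/eqP => /mpolyP/(_ a0); rewrite mcoeff0 raddf_sum /= big_mkcond /=.
  rewrite (bigD1_seq a0) ?msupp_uniq //= a0r eqxx mcoeffZ mcoeffX eqxx mulr1.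
  rewrite big1 ?addr0 => [/eqP|a na]; first by apply/negP; rewrite -mcoeff_msupp.
  by case: eqP => // _; rewrite mcoeffZ mcoeffX (negPf na) mulr0.
have hPr : Pr \is D.-homog.
  rewrite /Pr big_seq_cond; apply: dhomog_suml => a /andP [/hP aD _]; apply: dhomogZ.
  by rewrite dhomogX; apply/eqP.
(* The extra factor [X_0] yields a nonroot of [Pr] with nonzero first coordinate, which can then be
   scaled to 1. *)
have X0 : 'X_ord0 != 0 :> {mpoly k[n.+1]} by rewrite -msize_poly_eq0 msizeX.
have [v] := mpoly_nonroot (mulf_neq0 X0 Pr0).
rewrite mevalM mulf_eq0 mevalXU negb_or => /andP [v0 Prv].
pose v1 b := (v ord0)^-1 * v b.
have Prv1 : Pr.@[v1] != 0 by rewrite (meval_homog_scale _ _ hPr) mulf_neq0 // expf_neq0 ?invr_eq0.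
have [|u [u0 uP]] := hyp v1; first by rewrite /v1 mulVf.
pose G : {poly k} := \sum_(a <- msupp P) P@_a *: ('X^(ord a - r) * \prod_b u b ^+ a b).
have GP t : ('X^r * G).[t] = P.@[fun b => t ^+ (2 * (b != ord0)) * (u b).[t]].
  rewrite mevalE mulr_sumr horner_sum big_seq [RHS]big_seq; apply: eq_bigr => a aP.
  rewrite -scalerAr mulrA -exprD subnKC ?rmin // hornerZ hornerM hornerXn horner_prod.
  congr (_ * _); rewrite -prodrXr -big_split /=; apply: eq_bigr => b _.
  by rewrite exprMn -exprM horner_exp.
have : 'X^r * G = 0 by apply: poly_eq0_horner => t; rewrite GP.
move/eqP; rewrite mulf_eq0 -size_poly_eq0 size_polyXn /= => /eqP/(congr1 (horner^~ 0)).
rewrite horner0 horner_sum => /eqP; apply/negP; rewrite (_ : \sum_(_ <- _) _ = Pr.@[v1]) //.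
rewrite raddf_sum [RHS]big_mkcond /= big_seq [RHS]big_seq; apply: eq_bigr => a aP.
rewrite hornerZ hornerM hornerXn expr0n subn_eq0 horner_prod.
have := rmin a aP; rewrite leq_eqVlt eq_sym.
case: eqP => [-> _|_ /= ra]; last by rewrite leqNgt ra mul0r mulr0.
rewrite leqnn mul1r mevalZ mevalX; congr (_ * _); apply: eq_bigr => b _.
by rewrite horner_exp u0.
Qed.

Section ImageClosure.
Variables (k : closedFieldType) (N n : nat) (phi : N.-tuple {mpoly k[n]}).

Definition image_pset : pset k N :=
  fun v => exists w, forall j, v j = (tnth phi j).@[w].

Lemma image_pset_vanishes (f : {mpoly k[N]}) :
  vanishes f image_pset <-> f \mPo phi = 0.
Proof.
split=> [f0|f0 v [w vE]].
  by apply: mpoly_eq0_meval => w; rewrite comp_mpoly_meval f0 //; exists w.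
by rewrite (meval_eq _ vE) -comp_mpoly_meval f0 meval0.
Qed.

(** If neither closed piece is everything, each has an equation that pulls back to a nonzero
    polynomial. Where both pullbacks and one coordinate of [phi] are nonzero, the image point lies
    in neither piece. *)
Lemma zirred_image_closure w0 : nzvec (fun j => (tnth phi j).@[w0]) ->
  zirred (zclosure image_pset).
Proof.
move=> nz0; have [j0 w0j0] := nz0.
have memZ w : nzvec (fun j => (tnth phi j).@[w]) ->
    zclosure image_pset (fun j => (tnth phi j).@[w]).
  by move=> nz; split=> // f [_]; apply; exists w.
split; [exact: zclosed_zclosure | by eexists; apply: memZ nz0 |].
move=> Z1 Z2 [F1 [hF1 Z1E]] [F2 [hF2 Z2E]] ZE.
have sep F (Z : pset k N) : (forall v, Z v <-> zero_locus F v) -> (forall f, F f -> homogp f) ->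
    ~ psubset (zclosure image_pset) Z -> exists2 f, F f & f \mPo phi != 0.
  move=> FE hF nsub; apply: NNPP => nex; apply: nsub => v [nv vP]; apply/FE; split=> // f Ff.
  apply: vP; split; first exact: hF.
  by apply/image_pset_vanishes/eqP/negPn/negP => fphi; apply: nex; exists f.
apply: NNPP => /not_or_and [/(sep _ _ Z1E hF1) [f1 Ff1 f1n] /(sep _ _ Z2E hF2) [f2 Ff2 f2n]].
have pn : tnth phi j0 != 0 by apply: contraNneq w0j0 => ->; rewrite meval0.
have [w] := mpoly_nonroot (mulf_neq0 pn (mulf_neq0 f1n f2n)).
rewrite !mevalM !mulf_eq0 !negb_or => /andP [wj0 /andP [wf1 wf2]].
have /ZE : zclosure image_pset (fun j => (tnth phi j).@[w]) by apply: memZ; exists j0.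
case=> [/Z1E [_ /(_ f1 Ff1)]|/Z2E [_ /(_ f2 Ff2)]]; rewrite -comp_mpoly_meval => /eqP.
  by apply/negP.
by apply/negP.
Qed.

End ImageClosure.

Section FlagOfImages.
Variables (k : closedFieldType) (N m : nat) (phi : N.-tuple {mpoly k[m]}).

Definition ext_by0 (R : nmodType) (n i : nat) (w : 'I_i -> R) : 'I_n -> R :=
  fun a => if insub (a : nat) is Some b then w b else 0.

(** The restriction of [phi] to the subspace of the first [i] coordinates; the closures of these
    images form the chain. *)
Definition coord_restr i : N.-tuple {mpoly k[i]} :=
  [tuple tnth phi j \mPo [tuple @ext_by0 _ m i (fun b => 'X_b : {mpoly k[i]}) a | a < m] | j < N].

Lemma meval_coord_restr i j (w : 'I_i -> k) :
  (tnth (coord_restr i) j).@[w] = (tnth phi j).@[ext_by0 w].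
Proof.
rewrite tnth_mktuple comp_mpoly_meval; apply: meval_eq => a.
rewrite tnth_mktuple /ext_by0; case: insubP => [b _ _|_]; last exact: meval0.
exact: mevalXU.
Qed.

Lemma ext_by0_ext_by0 n i i' (w : 'I_i -> k) : (i <= i')%N ->
  @ext_by0 _ n i' (ext_by0 w) =1 ext_by0 w.
Proof.
move=> lei a; rewrite /ext_by0; case: insubP => [b _ <- //|].
rewrite -leqNgt => i'a; case: insubP => // c ai _.
by move: ai; rewrite ltnNge (leq_trans lei i'a).
Qed.

Lemma image_coord_restr_sub i i' v : (i <= i')%N ->
  image_pset (coord_restr i) v -> image_pset (coord_restr i') v.
Proof.
move=> lei [w vE]; exists (ext_by0 w) => j.
rewrite vE !meval_coord_restr; apply: meval_eq => a.
by rewrite ext_by0_ext_by0.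
Qed.

End FlagOfImages.

(* Leading terms [z_a ^+ 2] rather than [z_a] leave room for the second order effects
   needed in characteristic 2. *)
Lemma chain_of_family (k : closedFieldType) N m (S : pset k N)
    (phi : N.-tuple {mpoly k[m]}) (v0 : 'rV[k]_N) (A : 'M[k]_(m, N)) :
  (forall z, nzvec (fun j => (tnth phi j).@[z]) ->
     zclosure S (fun j => (tnth phi j).@[z])) ->
  row_free (col_mx v0 A) ->
  (forall z, exists R : 'I_N -> {poly k}, forall t j,
     (tnth phi j).@[fun a => t * z a] =
     v0 0 j + t ^+ 2 * (\sum_a z a ^+ 2 * A a j) + t ^+ 3 * (R j).[t]) ->
  has_chain (zclosure S) m.
Proof.
move=> phiS freeA expand.
pose psi := coord_restr phi.
have v0n : exists j, v0 0 j != 0.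
  apply/rV0Pn; apply/eqP => v00.
  have /(row_free_inj freeA) : row_mx 1%:M 0 *m col_mx v0 A = 0 *m col_mx v0 A.
    by rewrite mul_row_col v00 mulmx0 !mul0mx addr0.
  rewrite -[X in _ = X]row_mx0 => /eq_row_mx [/matrixP/(_ 0 0)/eqP].
  by rewrite !mxE oner_eq0.
have phi0 : nzvec (fun j => (tnth phi j).@[fun=> 0]).
  have [j v0j] := v0n; exists j.
  have [R hR] := expand (fun=> 0); have := hR 0 j.
  by rewrite !expr0n !mul0r !addr0 => ->.
have base i : nzvec (fun j => (tnth (psi i) j).@[fun=> 0]).
  have [j pj] := phi0; exists j; rewrite meval_coord_restr.
  rewrite (meval_eq (v2 := fun=> 0)) // => a.
  by rewrite /ext_by0; case: insubP.
exists (fun i => zclosure (image_pset (psi i))); split=> i lei.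
  split; first exact: zirred_image_closure (base i).
  move=> v [nv vP]; split=> // f [hf fS]; apply: vP; split=> //.
  case: hf => e hf u [w uE].
  have uE' j : u j = (tnth phi j).@[ext_by0 w] by rewrite uE meval_coord_restr.
  rewrite (meval_eq _ uE').
  have [|nz] := classic (nzvec (fun j => (tnth phi j).@[@ext_by0 _ m i w])).
    by move=> /phiS [_]; apply; split=> //; exists e.
  have [e0|e0] := posnP e.
    have [_ h] := phiS _ phi0; rewrite e0 in hf.
    rewrite (homog0_meval _ (fun j => (tnth phi j).@[fun=> 0]) hf).
    by apply: h; split=> //; exists 0%N.
  by apply: homog_meval0 hf e0 _ => j; apply: NNPP => h; apply: nz; exists j; apply/eqP.
split.
  move=> v [nv vP]; split=> // f [hf fi]; apply: vP; split=> // u iu.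
  by apply: fi; apply: image_coord_restr_sub iu.
apply: NNPP => nex.
have sub v : zclosure (image_pset (psi i.+1)) v -> zclosure (image_pset (psi i)) v.
  by move=> Zv; apply: NNPP => nZv; apply: nex; exists v.
(* The columns of this right inverse are linear functionals dual to [v0] and the leading terms. *)
pose Y := pinvmx (col_mx v0 A).
have YE : col_mx v0 A *m Y = 1%:M by rewrite mulmxVp.
have lei2 : (i.+2 <= 1 + m)%N by [].
pose wd := widen_ord lei2.
pose y := [tuple \sum_j Y j (wd b) *: 'X_j : {mpoly k[N]} | b < i.+2].
have yE b v : (tnth y b).@[v] = \sum_j Y j (wd b) * v j.
  by rewrite tnth_mktuple raddf_sum /=; apply: eq_bigr => j _; rewrite mevalZ mevalXU.
have hy b : tnth y b \is 1.-homog.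
  rewrite tnth_mktuple; apply: dhomog_suml => j _; apply: dhomogZ.
  by rewrite dhomogX; apply/eqP/mdeg1.
(* Pulled back to [i] parameters, the [i + 2] functionals satisfy a homogeneous relation. Were the
   closures for [i] and [i + 1] equal, it would persist with [i + 1] parameters, where the leading
   terms can be prescribed freely. *)
have [D [P [P0 hP Py]]] := homog_dependency [tuple tnth y b \mPo psi i | b < i.+2].
have hPy := dhomog_comp hP hy.
have Pyi : vanishes (P \mPo y) (image_pset (psi i)).
  apply/image_pset_vanishes; apply: mpoly_eq0_meval => w.
  have := congr1 (meval w) Py; rewrite meval0 !comp_mpoly_meval => <-.
  by apply: meval_eq => b; rewrite !tnth_mktuple comp_mpoly_meval.
have PyS w : (P \mPo y).@[fun j => (tnth (psi i.+1) j).@[w]] = 0.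
  have [nz|nz] := classic (nzvec (fun j => (tnth (psi i.+1) j).@[w])).
    have [|_] := sub (fun j => (tnth (psi i.+1) j).@[w]).
      by split=> // f [_]; apply; exists w.
    by apply; split=> //; eexists; exact: hPy.
  have [e0|e0] := posnP (1 * D)%N.
    rewrite e0 in hPy; rewrite (homog0_meval _ (fun j => (tnth (psi i) j).@[fun=> 0]) hPy).
    by apply: Pyi; exists (fun=> 0).
  by apply: homog_meval0 hPy e0 _ => j; apply: NNPP => h; apply: nz; exists j; apply/eqP.
case/eqP: P0; apply: (lowest_order_term hP) => v v0E.
(* Square roots make the leading terms [z_a ^+ 2] equal to the prescribed values. *)
have [w wE] := fin_all_exists (fun a : 'I_i.+1 => closed_sqrt (v (lift ord0 a))).
pose z := @ext_by0 _ m i.+1 w.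
have [R hR] := expand z.
pose R' b := \sum_j Y j (wd b) *: R j.
pose u (b : 'I_i.+2) := if unlift ord0 b is Some a then (v b)%:P + 'X * R' b
  else 1 + 'X^3 * R' b.
exists u; split=> [b|t].
  rewrite /u; case: unliftP => [a ->|->]; first by rewrite !hornerE ?mul0r ?addr0.
  by rewrite !hornerE ?expr0n ?mul0r ?addr0 v0E.
have := PyS (fun a => t * w a); rewrite comp_mpoly_meval => <-; apply: meval_eq => b.
rewrite yE.
have YS (l : 'I_(1 + m)) : \sum_j Y j (wd b) * col_mx v0 A l j = (l == wd b)%:R.
  have /matrixP/(_ l (wd b)) := YE; rewrite !mxE => <-.
  by apply: eq_bigr => j _; rewrite mulrC.
have psiE j : (tnth (psi i.+1) j).@[fun a => t * w a] =
    v0 0 j + t ^+ 2 * (\sum_a z a ^+ 2 * A a j) + t ^+ 3 * (R j).[t].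
  rewrite meval_coord_restr -hR; apply: meval_eq => a.
  by rewrite /z /ext_by0; case: insubP => [c _ _|_] //; rewrite mulr0.
have -> : \sum_j Y j (wd b) * (tnth (psi i.+1) j).@[fun a => t * w a] =
    (lshift m ord0 == wd b)%:R + t ^+ 2 * (\sum_a z a ^+ 2 * (rshift 1 a == wd b)%:R)
    + t ^+ 3 * (R' b).[t].
  rewrite -(YS (lshift m ord0)).
  rewrite (eq_bigr (fun a => z a ^+ 2 * \sum_j Y j (wd b) * col_mx v0 A (rshift 1 a) j)); last first.
    by move=> a _; rewrite YS.
  rewrite /R' horner_sum !mulr_sumr.
  rewrite (eq_bigr (fun a => \sum_j t ^+ 2 * (z a ^+ 2 * (Y j (wd b) * A a j)))); last first.
    move=> a _; rewrite !mulr_sumr; apply: eq_bigr => j _.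
    by rewrite col_mxEd.
  rewrite exchange_big -!big_split /=; apply: eq_bigr => j _.
  rewrite psiE col_mxEu hornerZ (_ : ord0 = 0) // !mulrDr -!addrA; congr (_ + _); congr (_ + _).
    rewrite !mulr_sumr; apply: eq_bigr => a _; ring.
  ring.
rewrite /u; case: unliftP => [a ->|->] /=.
  rewrite !hornerE.
  have lta : (a < m)%N by apply: leq_trans (ltn_ord a) _.
  rewrite (bigD1 (Ordinal lta)) //= big1 => [|c nc]; last first.
    case: eqP => [/(congr1 val) /= e|_]; last by rewrite mulr0.
    case/eqP: nc; apply/val_inj => /=; move: e; rewrite /bump /= !add1n.
    by case.
  rewrite (_ : rshift 1 _ == _ = true); last by apply/eqP/val_inj.
  rewrite /z /ext_by0 insubT => [|lta']; first exact: (ltn_ord a).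
  rewrite (_ : Sub _ _ = a) ?wE; last exact/val_inj.
  have -> : true%:R = 1 :> k by [].
  by ring.
rewrite !hornerE big1 => [|c _]; last exact: mulr0.
by ring.
Qed.

(** * Forms and vectors in three variables *)

(** Each monomial is charged to one variable that it contains, and that variable is divided out. *)
Lemma dhomog_sum_varM (R : comNzRingType) n (p : {mpoly R[n]}) d : p \is d.+1.-homog ->
  exists q : 'I_n -> {mpoly R[n]},
    (forall r, q r \is d.-homog) /\ p = \sum_r 'X_r * q r.
Proof.
move=> /dhomogP hp; pose var (m : 'X_{1..n}) := [pick r | m r != 0%N].
exists (fun r => \sum_(m <- msupp p | var m == Some r) p@_m *: 'X_[m - U_(r)]); split.
  move=> r; rewrite big_seq_cond; apply: dhomog_suml => m /andP [/hp /= dm /eqP].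
  rewrite /var; case: pickP => // s ms [<-]; apply: dhomogZ; rewrite dhomogX.
  apply/eqP => /=; have e : (U_(s) + (m - U_(s)) = m)%MM by rewrite addmC submK // lep1mP.
  by move: dm; rewrite -{1}e mdegD mdeg1 add1n => -[].
rewrite (eq_bigr (fun r => \sum_(m <- msupp p | var m == Some r) p@_m *: 'X_[m])); last first.
  move=> r _; rewrite mulr_sumr; apply: eq_bigr => m /eqP.
  rewrite /var; case: pickP => // s ms [<-].
  by rewrite -scalerAr -mpolyXD addmC submK // lep1mP.
rewrite (exchange_big_dep predT) //= {1}[p]mpolyE big_seq [RHS]big_seq; apply: eq_bigr => m mp.
rewrite /var; case: pickP => [s ms|m0].
  by rewrite (big_pred1 s) // => r; rewrite /= eq_sym.
by have := hp m mp; rewrite /= mdegE big1 // => r _; apply/eqP; have := m0 r; case: eqP.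
Qed.

Section FormCoordinates.
Variables (k : closedFieldType) (d : nat).
Local Notation N := #|{: mon d}|.

Definition mon_of (j : 'I_N) : 'X_{1..3} := bmnm (val (@enum_val (mon d) predT j)).

Lemma mon_of_inj : injective mon_of.
Proof. by move=> i j /val_inj/val_inj/enum_val_inj. Qed.

Lemma mdeg_mon_of j : mdeg (mon_of j) = d.
Proof. by rewrite /mon_of; case: (enum_val j) => m /= /eqP. Qed.

Lemma mon_ofP m : mdeg m = d -> exists j, m = mon_of j.
Proof.
move=> md; have lt : (mdeg m < d.+1)%N by rewrite md.
have e : mdeg (bmnm (BMultinom lt)) == d by rewrite /= md.
exists (enum_rank (exist _ (BMultinom lt) e : mon d)).
by rewrite /mon_of enum_rankK.
Qed.

Definition cvec (p : {mpoly k[3]}) : 'rV[k]_N := \row_j coords p j.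

Definition form (v : 'rV[k]_N) : {mpoly k[3]} := \sum_j v 0 j *: 'X_[mon_of j].

Lemma dhomog_form v : form v \is d.-homog.
Proof.
apply: dhomog_suml => j _; apply: dhomogZ; rewrite dhomogX; apply/eqP.
exact: mdeg_mon_of.
Qed.

Lemma cvec_linear : linear cvec.
Proof. by move=> c p q; apply/rowP => j; rewrite !mxE /coords linearP. Qed.
HB.instance Definition _ :=
  GRing.isLinear.Build k {mpoly k[3]} 'rV[k]_N _ cvec cvec_linear.

Lemma form_linear : linear form.
Proof.
move=> c u v; rewrite /form scaler_sumr -big_split; apply: eq_bigr => j _.
by rewrite !mxE scalerDl scalerA.
Qed.
HB.instance Definition _ :=
  GRing.isLinear.Build k 'rV[k]_N {mpoly k[3]} _ form form_linear.

Lemma coord_form v j : (form v)@_(mon_of j) = v 0 j.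
Proof.
rewrite raddf_sum (bigD1 j) //= mcoeffZ mcoeffX eqxx mulr1 big1 ?addr0 // => i ni.
by rewrite mcoeffZ mcoeffX (inj_eq mon_of_inj) (negPf ni) mulr0.
Qed.

Lemma formK : cancel form cvec.
Proof. by move=> v; apply/rowP => j; rewrite mxE /coords coord_form. Qed.

Lemma cvecK p : p \is d.-homog -> form (cvec p) = p.
Proof.
move=> hp; apply/mpolyP => m; have [md|md] := eqVneq (mdeg m) d.
  by have [j ->] := mon_ofP md; rewrite coord_form mxE.
by rewrite (dhomog_nemf_coeff (dhomog_form _) md) (dhomog_nemf_coeff hp md).
Qed.

End FormCoordinates.

Lemma card_mon d : #|{: mon d}| = 'C(d.+2, 2).
Proof.
rewrite -[d.+2]addn2 -(bin_sub (leq_addl d 2)) addnK -(size_basis 2 d).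
rewrite -(card_ord #|_|) cardE -(size_map (@mon_of d)).
apply: perm_size; apply: uniq_perm.
- by rewrite map_inj_uniq ?enum_uniq //; apply: mon_of_inj.
- exact: uniq_basis.
move=> m; rewrite -basis_cover; apply/mapP/eqP => [[j _ ->]|/mon_ofP [j ->]].
  exact: mdeg_mon_of.
by exists j; rewrite ?mem_enum.
Qed.

(** * Cross products and Cramer's rule *)

Section PlaneVectors.
Variable k : closedFieldType.
Implicit Types (a b u : 'I_3 -> k).

(** The indices run cyclically modulo 3, so one formula covers all coordinates. For distinct lines
    this is their intersection point. *)
Definition cross a b : 'I_3 -> k :=
  fun r => a (ordS r) * b (ord_pred r) - a (ord_pred r) * b (ordS r).

Lemma sum3E (V : nmodType) (F : 'I_3 -> V) r :
  \sum_s F s = F r + F (ordS r) + F (ord_pred r).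
Proof.
rewrite (bigD1 r) //= (bigD1 (ordS r)) /=; last by case: r => [[|[|[|]]]].
rewrite (bigD1 (ord_pred r)) /=; last by case: r => [[|[|[|]]]].
rewrite big1 ?addr0 ?addrA // => s; case: r s => [[|[|[|]]] //] r3 [[|[|[|]]] //].
Qed.

Lemma ordS3 (r : 'I_3) : ordS (ordS r) = ord_pred r.
Proof. by apply/val_inj; case: r => [[|[|[|]]]]. Qed.

Lemma ord_pred3 (r : 'I_3) : ord_pred (ord_pred r) = ordS r.
Proof. by apply/val_inj; case: r => [[|[|[|]]]]. Qed.

Lemma ord3P (r s : 'I_3) : [\/ s = r, s = ordS r | s = ord_pred r].
Proof.
by case: r s => [[|[|[|]]] // r3] [[|[|[|]]] // s3]; try (by constructor 1; apply/val_inj);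
  try (by constructor 2; apply/val_inj); constructor 3; apply/val_inj.
Qed.

Definition simpl3 := (ordS3, ord_pred3, ordSK, ord_predK).

Lemma dot3_crossl a b : dot3 a (cross a b) = 0.
Proof. rewrite /dot3 (sum3E _ ord0) /cross !simpl3; ring. Qed.

Lemma dot3_crossr a b : dot3 b (cross a b) = 0.
Proof. rewrite /dot3 (sum3E _ ord0) /cross !simpl3; ring. Qed.

Lemma dot3_crossC a b u : dot3 u (cross b a) = - dot3 u (cross a b).
Proof. rewrite /dot3 !(sum3E _ ord0) /cross !simpl3; ring. Qed.

Lemma dot3_cross_rot a b u : dot3 u (cross a b) = dot3 a (cross b u).
Proof. rewrite /dot3 !(sum3E _ ord0) /cross !simpl3; ring. Qed.

Lemma nzvec_cross a b u : dot3 u (cross a b) != 0 -> nzvec (cross a b).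
Proof.
move=> h; apply: NNPP => nz; case/eqP: h; rewrite /dot3 big1 // => r _.
case: (eqVneq (cross a b r) 0) => [->|n]; first by rewrite mulr0.
by case: nz; exists r.
Qed.

Lemma cross_eq0 a b : nzvec a -> ~ nzvec (cross a b) -> exists c, forall r, b r = c * a r.
Proof.
case=> r ar n; have cr s : cross a b s = 0.
  by apply/eqP/negPn/negP => cs; apply: n; exists s.
have := cr (ordS r); have := cr (ord_pred r); rewrite /cross !simpl3 => /eqP.
rewrite subr_eq0 => /eqP e1 /eqP; rewrite subr_eq0 => /eqP e2.
exists (b r / a r) => s; case: (ord3P r s) => ->.
- by rewrite divfK.
- by apply: (mulfI ar); rewrite e1; field.
by apply: (mulfI ar); rewrite -e2; field.
Qed.

(** Cramer's rule: two of the three equations are solved with the minor at a nonzero coordinate [r]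
    of the cross product, and the vanishing determinant gives the third. *)
Lemma dot3_cross_eq0 a b u : nzvec (cross a b) -> dot3 u (cross a b) = 0 ->
  exists alpha beta, forall r, u r = alpha * a r + beta * b r.
Proof.
case=> r pr; rewrite /dot3 (sum3E _ r) => e.
exists (cross u b r / cross a b r), (cross a u r / cross a b r) => s.
apply: (mulIf pr).
have -> : (cross u b r / cross a b r * a s + cross a u r / cross a b r * b s) * cross a b r
  = cross u b r * a s + cross a u r * b s by field.
case: (ord3P r s) => ->; move: e; rewrite /cross !simpl3 => e.
- by apply/eqP; rewrite -subr_eq0 -[X in _ == X]e; apply/eqP; ring.
- by ring.
by ring.
Qed.

End PlaneVectors.

(** * The ideal of a star configuration *)

Section LinearForms.
Variable R : comNzRingType.

Definition linf (a : 'I_3 -> R) : {mpoly R[3]} := \sum_r a r *: 'X_r.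

Lemma dhomog_linf a : linf a \is 1.-homog.
Proof.
by apply: dhomog_suml => r _; apply: dhomogZ; rewrite dhomogX; apply/eqP/mdeg1.
Qed.

Lemma meval_linf a x : (linf a).@[x] = \sum_r a r * x r.
Proof. by rewrite raddf_sum; apply: eq_bigr => r _; rewrite /= mevalZ mevalXU. Qed.

Lemma linfD a b : linf (fun r => a r + b r) = linf a + linf b.
Proof. by rewrite -big_split; apply: eq_bigr => r _; rewrite scalerDl. Qed.

Lemma linfZ c a : linf (fun r => c * a r) = c *: linf a.
Proof. by rewrite scaler_sumr; apply: eq_bigr => r _; rewrite scalerA. Qed.

Lemma eq_linf a b : a =1 b -> linf a = linf b.
Proof. by move=> e; apply: eq_bigr => r _; rewrite e. Qed.

Variable L : 'I_6 -> 'I_3 -> R.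

Definition prod_but1 i : {mpoly R[3]} := \prod_(r | r != i) linf (L r).
Definition prod_but2 i j : {mpoly R[3]} := \prod_(r | (r != i) && (r != j)) linf (L r).
Definition star_form (g : 'I_6 -> {mpoly R[3]}) := \sum_i g i * prod_but1 i.

Lemma prod_but1E i j : i != j -> prod_but1 j = linf (L i) * prod_but2 i j.
Proof.
by move=> ij; rewrite /prod_but1 (bigD1 i) //=; congr (_ * _); apply: eq_bigl => r; rewrite andbC.
Qed.

Lemma prod_but2C i j : prod_but2 i j = prod_but2 j i.
Proof. by apply: eq_bigl => r; rewrite andbC. Qed.

Lemma dhomog_prod_but1 i : prod_but1 i \is 5.-homog.
Proof.
have := dhomog_prodl (index_enum _) (P := [pred r | r != i]) (fun r _ => dhomog_linf (L r)).
by rewrite sum1_card cardC1 card_ord.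
Qed.

Lemma dhomog_prod_but2 i j : i != j -> prod_but2 i j \is 4.-homog.
Proof.
move=> ij.
have := dhomog_prodl (index_enum _) (P := [pred r | (r != i) && (r != j)])
  (fun r _ => dhomog_linf (L r)).
suff -> : (\sum_(r < 6 | (r != i) && (r != j)) 1 = 4)%N by [].
have := cardC1 i; rewrite card_ord -sum1_card (bigD1 j) /= => [[] e|].
  by rewrite -[RHS]e; apply: eq_bigl => r; rewrite !inE.
by rewrite !inE eq_sym.
Qed.

Lemma dhomog_star_form e g : (forall i, g i \is e.-homog) -> star_form g \is (e + 5)%N.-homog.
Proof.
by move=> hg; apply: dhomog_suml => i _; apply: dhomogM (hg i) (dhomog_prod_but1 i).
Qed.

End LinearForms.

Lemma star_formD (R : comNzRingType) (L : 'I_6 -> 'I_3 -> R) g g' :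
  star_form L (fun i => g i + g' i) = star_form L g + star_form L g'.
Proof. by rewrite -big_split; apply: eq_bigr => i _; rewrite mulrDl. Qed.

Lemma star_formM (R : comNzRingType) (L : 'I_6 -> 'I_3 -> R) q g :
  star_form L (fun i => q * g i) = q * star_form L g.
Proof. by rewrite mulr_sumr; apply: eq_bigr => i _; rewrite mulrA. Qed.

Section StarConfigurations.
Variable k : closedFieldType.
Implicit Types (L : 'I_6 -> 'I_3 -> k).

Definition vertex L i j := cross (L i) (L j).

(** General position as the nonvanishing of polynomials in the lines. As there are at least three
    lines, it also forces them to be nonzero and distinct. *)
Definition no_concurrent L := forall i j m, i != j -> j != m -> i != m ->
  dot3 (L m) (vertex L i j) != 0.

(** If a determinant vanishes, either the cross product is a common point of three lines, or it is
    zero and two lines coincide. *)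
Lemma in_D_no_concurrent L : in_D L -> no_concurrent L.
Proof.
move=> [nz dist conc] i j m ij jm im; apply/eqP => e.
have [nzv|nv] := classic (nzvec (vertex L i j)).
  apply: (conc i j m) => //; exists (vertex L i j); split=> //.
    exact: dot3_crossl.
  exact: dot3_crossr.
have [c cE] := cross_eq0 (nz i) nv.
apply: (dist _ _ ij) => x _.
have dj : dot3 (L j) x = c * dot3 (L i) x.
  by rewrite /dot3 mulr_sumr; apply: eq_bigr => r _; rewrite cE mulrA.
rewrite /on_line dj; split=> [->|/eqP]; first by rewrite mulr0.
rewrite mulf_eq0 => /orP [/eqP c0|/eqP //]; have [r] := nz j.
by rewrite cE c0 mul0r eqxx.
Qed.

Lemma ex_third (i j : 'I_6) : exists2 m, m != i & m != j.
Proof.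
have : (0 < #|[pred m : 'I_6 | (m != i) && (m != j)]|)%N.
  have := cardC (pred2 i j); rewrite card2 card_ord => e.
  apply: (@leq_trans #|predC (pred2 i j)|); first by
    rewrite -(ltn_add2l (i != j).+1) e addn0; case: (i != j).
  by apply: subset_leq_card; apply/subsetP => m; rewrite !inE negb_or.
by case/card_gt0P => m; rewrite !inE => /andP [mi mj]; exists m.
Qed.

Lemma nzvec_vertex L i j : no_concurrent L -> i != j -> nzvec (vertex L i j).
Proof.
move=> nc ij; have [m mi mj] := ex_third i j.
by apply: (@nzvec_cross _ _ _ (L m)); apply: nc; rewrite // eq_sym.
Qed.

Lemma no_concurrent_in_D L : no_concurrent L -> in_D L.
Proof.
move=> nc; split=> [i|i j ij same|i j m ij jm im [x [[r xr] xi xj xm]]].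
- have [j ji _] := ex_third i i; have [r] := nzvec_vertex nc ji; rewrite /vertex /cross => h.
  apply: NNPP => nz; case/eqP: h.
  have z s : L i s = 0 by apply/eqP/negPn/negP => n; apply: nz; exists s.
  by rewrite !z; ring.
- have [m mi mj] := ex_third i j.
  rewrite eq_sym in mi; have := nc i m j mi mj ij.
  have [h _] := same _ (nzvec_vertex nc mi).
  by rewrite /on_line in h; rewrite h ?eqxx // dot3_crossl.
have /negP := nc i j m ij jm im; apply; apply/eqP.
have := xi; have := xj; have := xm; rewrite /on_line /vertex /dot3 !(sum3E _ r) /cross !simpl3.
set A := L m; set B := L j; set C := L i => e1 e2 e3; apply: (mulIf xr).
(* Cofactor expansion: the determinant times [x r] is a combination of the values of the three lines
   at [x]. *)
transitivity ((A r * x r + A (ordS r) * x (ordS r) + A (ord_pred r) * x (ord_pred r)) * cross C B r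
   + (B r * x r + B (ordS r) * x (ordS r) + B (ord_pred r) * x (ord_pred r)) * cross A C r
   + (C r * x r + C (ordS r) * x (ordS r) + C (ord_pred r) * x (ord_pred r)) * cross B A r).
  rewrite /cross; ring.
by rewrite e1 e2 e3; ring.
Qed.

Lemma meval_linf_vertex L r i j : r \in [:: i; j] -> (linf (L r)).@[vertex L i j] = 0.
Proof.
rewrite meval_linf !inE => /orP [] /eqP ->; first exact: dot3_crossl.
exact: dot3_crossr.
Qed.

Lemma meval_prod_but1_vertex L m i j : i != j -> (prod_but1 L m).@[vertex L i j] = 0.
Proof.
move=> ij; rewrite rmorph_prod /=; case: (eqVneq i m) => [im|im].
  rewrite (bigD1 j) /=; last by rewrite -im eq_sym.
  by rewrite meval_linf_vertex ?mul0r // !inE eqxx orbT.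
by rewrite (bigD1 i) //= meval_linf_vertex ?mul0r // !inE eqxx.
Qed.

Lemma meval_star_form_vertex L g i j : i != j -> (star_form L g).@[vertex L i j] = 0.
Proof.
move=> ij; rewrite raddf_sum big1 //= => m _.
by rewrite mevalM meval_prod_but1_vertex // mulr0.
Qed.

Lemma contains_star_form L g : contains_star (star_form L g) L.
Proof.
move=> x [nx [i [j [ij [xi xj]]]]]; rewrite raddf_sum big1 //= => m _.
rewrite mevalM rmorph_prod /=.
have [im|im] := eqVneq i m.
  rewrite (bigD1 j) /=; last by rewrite -im eq_sym.
  by rewrite meval_linf -/(dot3 _ _) xj mul0r mulr0.
by rewrite (bigD1 i) //= meval_linf -/(dot3 _ _) xi mul0r mulr0.
Qed.

(** Two different vertices share at most one line, so line [a] or line [b] is among the factors. *)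
Lemma meval_prod_but2_vertex L (i j a b : 'I_6) : a != b -> (a < b)%N -> (i < j)%N ->
  (a, b) != (i, j) -> (prod_but2 L i j).@[vertex L a b] = 0.
Proof.
move=> ab ltab ltij; rewrite xpair_eqE negb_and => ne.
rewrite rmorph_prod /=.
suff [r rab /andP [ri rj]] : exists2 r, r \in [:: a; b] & (r != i) && (r != j).
  by rewrite (bigD1 r) /= ?ri //= meval_linf_vertex ?mul0r.
have [ai|ai] := boolP ((a != i) && (a != j)); first by exists a; rewrite ?inE ?eqxx.
exists b; rewrite ?inE ?eqxx ?orbT //.
move: ab ltab ltij ne ai; rewrite -!val_eqE /=; lia.
Qed.

Lemma meval_prod_but2_neq0 L i j : no_concurrent L -> i != j ->
  (prod_but2 L i j).@[vertex L i j] != 0.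
Proof.
move=> nc ij; rewrite rmorph_prod /=; apply/prodf_neq0 => r /andP [ri rj].
by rewrite meval_linf; apply: nc; rewrite // eq_sym.
Qed.

Definition pair6 := {q : 'I_6 * 'I_6 | (q.1 < q.2)%N}.

Lemma card_pair6 : #|{: pair6}| = 15.
Proof.
rewrite card_sig -sum1_card.
rewrite (eq_bigl (fun q : 'I_6 * 'I_6 => true && (q.1 < q.2)%N)) //.
rewrite -(pair_big_dep xpredT (fun i j : 'I_6 => (i < j)%N) (fun _ _ => 1%N)) /=.
under eq_bigr => i _ do rewrite big_mkcond.
by rewrite !big_ord_recl !big_ord0.
Qed.

Lemma pair6_neq (q : pair6) : (val q).1 != (val q).2.
Proof. by case: q => -[i j] /= ij; rewrite -val_eqE /= ltn_eqF. Qed.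

Definition pvertex L (q : pair6) := vertex L (val q).1 (val q).2.
Definition pprod L (q : pair6) := prod_but2 L (val q).1 (val q).2.

Lemma dhomog_pprod L q : pprod L q \is 4.-homog.
Proof. exact: dhomog_prod_but2 (pair6_neq q). Qed.

Lemma meval_pprod_vertex L q q' : q' != q -> (pprod L q).@[pvertex L q'] = 0.
Proof.
case: q q' => -[i j] ij [[a b] ab] ne; apply: meval_prod_but2_vertex => //.
by rewrite -val_eqE /= ltn_eqF.
Qed.

Lemma meval_pprod_neq0 L q : no_concurrent L -> (pprod L q).@[pvertex L q] != 0.
Proof. by move=> nc; apply: meval_prod_but2_neq0 (pair6_neq q). Qed.

(* The part of degree [e + 4], so that the case [e = 0] is the zero quartic. *)
Definition star_ideal L e (p : {mpoly k[3]}) :=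
  if e is e'.+1 then exists g, (forall i, g i \is e'.-homog) /\ p = star_form L g else p = 0.

Lemma star_ideal0 L e : star_ideal L e 0.
Proof.
case: e => [//|e] /=; exists (fun=> 0); split=> [i|]; first exact: dhomog0.
by rewrite /star_form big1 // => i _; rewrite mul0r.
Qed.

Lemma star_idealD L e p q : star_ideal L e p -> star_ideal L e q -> star_ideal L e (p + q).
Proof.
case: e => [-> ->|e] /=; first by rewrite addr0.
move=> [g [hg ->]] [g' [hg' ->]]; exists (fun i => g i + g' i).
by rewrite star_formD; split=> // i; apply: dhomogD.
Qed.

Lemma star_ideal_sum L e (I : Type) (s : seq I) (P : pred I) (F : I -> {mpoly k[3]}) :
  (forall i, P i -> star_ideal L e (F i)) -> star_ideal L e (\sum_(i <- s | P i) F i).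
Proof.
move=> hF; elim/big_rec: _ => [|i p Pi]; first exact: star_ideal0.
by apply: star_idealD; apply: hF.
Qed.

Lemma star_idealM L e e' q p : q \is e'.-homog -> star_ideal L e p ->
  star_ideal L (e' + e) (q * p).
Proof.
move=> hq; case: e => [->|e] /=; first by rewrite mulr0; apply: star_ideal0.
move=> [g [hg ->]]; rewrite addnS /=; exists (fun i => q * g i).
by rewrite star_formM; split=> // i; apply: dhomogM.
Qed.

Lemma star_idealZ L e c p : star_ideal L e p -> star_ideal L e (c *: p).
Proof.
rewrite -mul_mpolyC -[e in star_ideal L e (_ * _)]add0n; apply: star_idealM.
by rewrite -alg_mpolyC; apply: dhomogZ; apply: dhomog1.
Qed.

Lemma star_ideal_prod_but1 L i : star_ideal L 1 (prod_but1 L i).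
Proof.
exists (fun j => (j == i)%:R); split=> [j|].
  by case: (j == i); rewrite ?dhomog1 ?dhomog0.
rewrite /star_form (bigD1 i) //= eqxx mul1r big1 ?addr0 // => j /negPf ->.
by rewrite mul0r.
Qed.

Lemma star_ideal_meval L e p q : star_ideal L e p -> p.@[pvertex L q] = 0.
Proof.
case: e => [->|e] /=; first exact: meval0.
by move=> [g [_ ->]]; apply: meval_star_form_vertex (pair6_neq q).
Qed.

Lemma star_ideal_dhomog L e p : star_ideal L e p -> p \is (e + 4)%N.-homog.
Proof.
case: e => [->|e] /=; first exact: dhomog0.
by move=> [g [hg ->]]; rewrite addSnnS; apply: dhomog_star_form.
Qed.

(** Subtracting the right multiple of [h] from [u] leaves a linear form vanishing at the vertex,
    hence a combination of the two lines meeting there; times the other four lines, each of these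
    becomes a [prod_but1]. So modulo the ideal any linear factor can be traded for a multiple of
    [h]. *)
Lemma star_ideal_linM L h u q : dot3 h (pvertex L q) != 0 -> no_concurrent L ->
  star_ideal L 1 (linf u * pprod L q -
    (dot3 u (pvertex L q) / dot3 h (pvertex L q)) *: (linf h * pprod L q)).
Proof.
move=> hq nc; have ij := pair6_neq q; set c := _ / _.
have nz := nzvec_vertex nc ij.
have [|a [b abE]] := @dot3_cross_eq0 _ _ _ (fun r => u r + (- c) * h r) nz.
  rewrite /dot3 (eq_bigr (fun r => u r * pvertex L q r + (- c) * (h r * pvertex L q r))).
    by rewrite big_split -mulr_sumr /= -!/(dot3 _ _) /c mulNr divfK // subrr.
  by move=> r _; rewrite mulrDl mulrA.
have -> : linf u * pprod L q - c *: (linf h * pprod L q) =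
    a *: prod_but1 L (val q).2 + b *: prod_but1 L (val q).1.
  rewrite scalerAl -mulrBl -scaleNr -linfZ -linfD (eq_linf abE) linfD !linfZ.
  rewrite mulrDl -!scalerAl; congr (_ *: _ + _ *: _).
    by rewrite (prod_but1E _ ij).
  by rewrite (prod_but1E L (i := (val q).2)) ?(eq_sym (val q).2) // prod_but2C.
by apply: star_idealD; apply: star_idealZ; apply: star_ideal_prod_but1.
Qed.

(** Values at the vertices show the 15 products to be independent, and 15 is also the number of
    quartic monomials. *)
Lemma quartic_span L p : no_concurrent L -> p \is 4.-homog ->
  exists c, p = \sum_q c q *: pprod L q.
Proof.
move=> nc hp.
pose A : 'M[k]_(#|{: pair6}|, #|{: mon 4}|) := \matrix_i cvec 4 (pprod L (enum_val i)).
have freeA : row_free A.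
  rewrite -kermx_eq0; apply/eqP/row_matrixP => i; rewrite row0.
  have : row i (kermx A) *m A = 0 by rewrite -row_mul mulmx_ker row0.
  set u := row i _ => uA; apply/rowP => j; rewrite [RHS]mxE.
  have : \sum_i u 0 i *: pprod L (enum_val i) = 0.
    rewrite -[RHS](linear0 (form (d := 4))) -uA mulmx_sum_row raddf_sum /=.
    apply: eq_bigr => l _; rewrite rowK linearZ /= cvecK //; exact: dhomog_pprod.
  move/(congr1 (meval (pvertex L (enum_val j)))); rewrite meval0 raddf_sum /=.
  rewrite (bigD1 j) //= big1 ?addr0 => [|l lj].
    by rewrite mevalZ => /eqP; rewrite mulf_eq0 (negPf (meval_pprod_neq0 _ nc)) orbF => /eqP.
  by rewrite mevalZ meval_pprod_vertex ?mulr0 // (inj_eq enum_val_inj) eq_sym.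
have fullA : row_full A by rewrite /row_full (eqP freeA) card_pair6 card_mon.
have [u uE] : exists u, cvec 4 p = u *m A by apply/submxP; rewrite submx_full.
exists (fun q => u 0 (enum_rank q)).
rewrite -[LHS](cvecK hp) uE mulmx_sum_row raddf_sum /=.
rewrite (reindex_onto enum_rank enum_val) /=; last by move=> i _; rewrite enum_valK.
rewrite (eq_bigl xpredT) => [|q]; last by rewrite enum_rankK eqxx.
apply: eq_bigr => q _; rewrite rowK enum_rankK linearZ /= cvecK //.
exact: dhomog_pprod.
Qed.

End StarConfigurations.

Lemma dhomog_linfX (R : comNzRingType) (h : 'I_3 -> R) e : linf h ^+ e \is e.-homog.
Proof. by have := dhomogMn e (dhomog_linf h); rewrite mul1n. Qed.

Lemma linf_neq0 (R : comNzRingType) (a : 'I_3 -> R) r : a r != 0 -> linf a != 0.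
Proof.
apply: contraNneq => a0; have := meval_linf a (fun s => (s == r)%:R).
rewrite a0 meval0 (bigD1 r) //= eqxx mulr1 big1 ?addr0 => [<-//|s /negPf ->].
by rewrite mulr0.
Qed.

(** * The ideal in all degrees and evaluation at the vertices *)

Section IdealOfStar.
Variable k : closedFieldType.
Implicit Types (L : 'I_6 -> 'I_3 -> k).

(** The vertices are nonzero linear forms on the dual plane, so their product has a nonroot. *)
Lemma exists_line_off_vertices L : no_concurrent L ->
  exists h, forall q, dot3 h (pvertex L q) != 0.
Proof.
move=> nc; have : \prod_q linf (pvertex L q) != 0.
  by apply/prodf_neq0 => q _; have [r /linf_neq0] := nzvec_vertex nc (pair6_neq q).
case/mpoly_nonroot => h; rewrite rmorph_prod /= => /prodf_neq0 hP; exists h => q.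
rewrite /dot3 (eq_bigr (fun r => pvertex L q r * h r)) => [|r _]; last exact: mulrC.
by rewrite -meval_linf hP.
Qed.

(** Induction on the degree: a form is [sum_r x_r s_r], and [star_ideal_linM] replaces each [x_r] in
    front of a product of four lines by a multiple of [h]. *)
Lemma star_ideal_complement L h e p : no_concurrent L ->
  (forall q, dot3 h (pvertex L q) != 0) -> p \is (e + 4)%N.-homog ->
  exists c, star_ideal L e (p - linf h ^+ e * \sum_q c q *: pprod L q).
Proof.
move=> nc hq; elim: e p => [|e IH] p hp.
  by have [c ->] := quartic_span nc hp; exists c; rewrite expr0 mul1r subrr.
have [s [hs ps]] := dhomog_sum_varM hp.
have [c hc] := fin_all_exists (fun r => IH (s r) (hs r)).
pose u r := fun t : 'I_3 => (t == r)%:R : k.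
have uX r : linf (u r) = 'X_r.
  rewrite /linf (bigD1 r) //= /u eqxx scale1r big1 ?addr0 // => t /negPf ->.
  by rewrite scale0r.
pose K r q := dot3 (u r) (pvertex L q) / dot3 h (pvertex L q).
exists (fun q => \sum_r c r q * K r q).
have -> : p - linf h ^+ e.+1 * (\sum_q (\sum_r c r q * K r q) *: pprod L q) =
  \sum_r ('X_r * (s r - linf h ^+ e * \sum_q c r q *: pprod L q) +
    \sum_q (linf h ^+ e * (c r q *: (linf (u r) * pprod L q - K r q *: (linf h * pprod L q))))).
  rewrite ps; under [X in _ - _ * X]eq_bigr => q _ do rewrite scaler_suml.
  rewrite exchange_big mulr_sumr -sumrB; apply: eq_bigr => r _.
  have -> : \sum_q linf h ^+ e * (c r q *: (linf (u r) * pprod L q - K r q *: (linf h * pprod L q)))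
    = 'X_r * (linf h ^+ e * \sum_q c r q *: pprod L q) -
      linf h ^+ e.+1 * \sum_q (c r q * K r q) *: pprod L q.
    rewrite !mulr_sumr -sumrB; apply: eq_bigr => q _.
    by move: (K r q) => kap; rewrite uX -!mul_mpolyC mpolyCM exprS; ring.
  by rewrite mulrBr addrA subrK.
apply: star_ideal_sum => r _; apply: star_idealD.
  by apply: (@star_idealM _ L e 1) (hc r); rewrite dhomogX; apply/eqP/mdeg1.
apply: star_ideal_sum => q _.
rewrite -addn1; apply: star_idealM; last first.
  by apply: star_idealZ; apply: star_ideal_linM.
exact: dhomog_linfX.
Qed.

Lemma meval_linf_pprod L h e q q' : q' != q -> (linf h ^+ e * pprod L q).@[pvertex L q'] = 0.
Proof. by move=> ne; rewrite mevalM meval_pprod_vertex // mulr0. Qed.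

Lemma meval_linf_sum_pprod L h e c q :
  (linf h ^+ e * \sum_q c q *: pprod L q).@[pvertex L q] =
  c q * (linf h ^+ e * pprod L q).@[pvertex L q].
Proof.
rewrite -mevalZ scalerAr (bigD1 q) //= mulrDr mevalD [X in _ + X](_ : _ = 0) ?addr0 //.
rewrite mulr_sumr rmorph_sum big1 //= => q' ne.
by rewrite -scalerAr mevalZ meval_linf_pprod ?mulr0 // eq_sym.
Qed.

Lemma meval_linf_pprod_neq0 L h e q : no_concurrent L -> dot3 h (pvertex L q) != 0 ->
  (linf h ^+ e * pprod L q).@[pvertex L q] != 0.
Proof.
move=> nc hq; rewrite mevalM mulf_neq0 ?meval_pprod_neq0 // rmorphXn /= expf_neq0 //.
by rewrite meval_linf.
Qed.

Lemma dhomog_linf_pprod L (h : 'I_3 -> k) e q : linf h ^+ e * pprod L q \is (e + 4)%N.-homog.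
Proof.
exact: dhomogM (dhomog_linfX _ _) (dhomog_pprod _ _).
Qed.

(** Evaluation at a vertex isolates one coefficient of the complement, so vanishing at all vertices
    leaves only the ideal part. *)
Lemma star_idealP L e p : no_concurrent L -> p \is (e + 4)%N.-homog ->
  (forall q, p.@[pvertex L q] = 0) -> star_ideal L e p.
Proof.
move=> nc hp p0; have [h hq] := exists_line_off_vertices nc.
have [c hc] := star_ideal_complement nc hq hp.
suff c0 q : c q = 0.
  by move: hc; rewrite big1 => [|q _]; rewrite ?c0 ?scale0r // mulr0 subr0.
have /eqP := star_ideal_meval q hc; rewrite mevalB p0 sub0r meval_linf_sum_pprod.
by rewrite oppr_eq0 mulf_eq0 (negPf (meval_linf_pprod_neq0 _ nc _)) // orbF => /eqP.
Qed.

(** Such a functional factors through the quotient by the ideal, on which the values at the vertices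
    are coordinates; [mu q] is its value on the normalised form dual to the vertex [q]. *)
Lemma functional_killing_star_ideal L e (lam : {scalar {mpoly k[3]}}) : no_concurrent L ->
  (forall p, star_ideal L e p -> lam p = 0) ->
  exists mu, forall p, p \is (e + 4)%N.-homog -> lam p = \sum_q mu q * p.@[pvertex L q].
Proof.
move=> nc lam0; have [h hq] := exists_line_off_vertices nc.
exists (fun q => lam (linf h ^+ e * pprod L q) / (linf h ^+ e * pprod L q).@[pvertex L q]).
move=> p hp; have [c hc] := star_ideal_complement nc hq hp.
have /eqP := lam0 _ hc; rewrite linearB subr_eq0 => /eqP ->.
rewrite mulr_sumr linear_sum; apply: eq_bigr => q _.
have -> : p.@[pvertex L q] = c q * (linf h ^+ e * pprod L q).@[pvertex L q].
  have /eqP := star_ideal_meval q hc; rewrite mevalB subr_eq0 => /eqP ->.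
  exact: meval_linf_sum_pprod.
rewrite -scalerAr linearZ /= mulrCA divfK //.
exact: meval_linf_pprod_neq0.
Qed.

Variable e : nat.
Local Notation d := (e.+1 + 4)%N.
Local Notation N := #|{: mon d}|.
Local Notation G := ('I_6 * 'I_#|{: mon e}|)%type.

Definition star_gen L (b : G) : {mpoly k[3]} := 'X_[mon_of b.2] * prod_but1 L b.1.

Lemma star_gen_ideal L b : star_ideal L e.+1 (star_gen L b).
Proof.
rewrite -[e.+1]addn1; apply: star_idealM; last exact: star_ideal_prod_but1.
by rewrite dhomogX; apply/eqP/mdeg_mon_of.
Qed.

Lemma dhomog_star_gen L b : star_gen L b \is d.-homog.
Proof. exact: star_ideal_dhomog (star_gen_ideal L b). Qed.

Definition star_mx L : 'M[k]_(#|{: G}|, N) := \matrix_b cvec d (star_gen L (enum_val b)).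

Lemma cvec_star_ideal L p : star_ideal L e.+1 p -> (cvec d p <= star_mx L)%MS.
Proof.
move=> [g [hg ->]]; rewrite /star_form linear_sum; apply: summx_sub => i _ /=.
rewrite -[g i](cvecK (hg i)) mulr_suml linear_sum; apply: summx_sub => j _.
rewrite -scalerAl linearZ /=; apply: scalemx_sub.
have -> : cvec d ('X_[mon_of j] * prod_but1 L i) = row (enum_rank (i, j)) (star_mx L).
  by rewrite rowK enum_rankK.
exact: row_sub.
Qed.

(** The rows lie in the kernel of evaluation at the 15 vertices, which has rank 15 because the forms
    [h^(e+1) pprod] are dual to the vertices up to scale. *)
Lemma rank_star_mx L : no_concurrent L -> (\rank (star_mx L) <= N - 15)%N.
Proof.
move=> nc; have [h hq] := exists_line_off_vertices nc.
pose E : 'M[k]_(N, #|{: pair6}|) :=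
  \matrix_(j, q) ('X_[mon_of j] : {mpoly k[3]}).@[pvertex L (enum_val q)].
have cvecE p q : p \is d.-homog -> (cvec d p *m E) 0 q = p.@[pvertex L (enum_val q)].
  move=> hp; rewrite -{2}(cvecK hp) mxE raddf_sum /=; apply: eq_bigr => j _.
  by rewrite mevalZ [E j q]mxE.
have JE : star_mx L *m E = 0.
  apply/row_matrixP => b; rewrite row_mul rowK row0; apply/rowP => q.
  by rewrite cvecE ?dhomog_star_gen // (star_ideal_meval _ (star_gen_ideal L _)) mxE.
have rkE : \rank E = 15.
  apply/eqP; rewrite -card_pair6 -/(row_full E) -col_leq_rank.
  pose A : 'M[k]_(#|{: pair6}|, N) :=
    \matrix_q ((linf h ^+ e.+1 * pprod L (enum_val q)).@[pvertex L (enum_val q)]^-1 *: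
      cvec d (linf h ^+ e.+1 * pprod L (enum_val q))).
  have AE : A *m E = 1%:M.
    apply/row_matrixP => q; rewrite row_mul rowK row1 -scalemxAl; apply/rowP => q'.
    rewrite mxE cvecE ?dhomog_linf_pprod // !mxE eqxx /= [q' == q]eq_sym.
    case: eqVneq => [<-|ne]; first by rewrite mulVf ?meval_linf_pprod_neq0.
    by rewrite [X in _ * X]meval_linf_pprod ?mulr0 // (inj_eq enum_val_inj) eq_sym.
  by apply: leq_trans (mxrankM_maxr A E); rewrite AE mxrank1.
have := mxrankS (introT sub_kermxP JE); rewrite mxrank_ker rkE.
by [].
Qed.

(** The selection varies in a finite set, which keeps the number of charts finite. When the rank is
    below [r], the row [i0] fills the remaining places. *)
Lemma select_rows (K r : nat) (i0 : 'I_K) (A : 'M[k]_(K, N)) u : (\rank A <= r)%N -> (u <= A)%MS ->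
  exists (sel : 'I_r -> 'I_K) (c : 'rV[k]_r), u = \sum_j c 0 j *: row (sel j) A.
Proof.
move=> rk uA.
pose sel (j : 'I_r) := if insub (j : nat) is Some j' then maxrankfun A j' else i0.
have /submxP [c cE] : (u <= rowsub sel A)%MS.
  apply: submx_trans uA _; rewrite -(eq_maxrowsub A).
  apply/row_subP => i; have -> : row i (rowsub (maxrankfun A) A) = row (widen_ord rk i) (rowsub sel A).
    apply/rowP => j; rewrite !mxE; congr (A _ _).
    rewrite /sel insubT /= => [|lti]; first exact: ltn_ord.
    by congr (maxrankfun A _); apply/val_inj.
  exact: row_sub.
exists sel, c; rewrite cE mulmx_sum_row; apply: eq_bigr => j _; congr (_ *: _).
by apply/rowP => l; rewrite !mxE.
Qed.

End IdealOfStar.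

(** * Charts and the upper bound *)

Section Naturality.
Variables (R S : comNzRingType) (f : {rmorphism R -> S}).

Lemma map_linf a : map_mpoly f (linf a) = linf (f \o a).
Proof.
by rewrite rmorph_sum; apply: eq_bigr => r _; rewrite /= map_mpolyZ map_mpolyX.
Qed.

Lemma map_prod_but1 L i : map_mpoly f (prod_but1 L i) = prod_but1 (fun j => f \o L j) i.
Proof. by rewrite rmorph_prod; apply: eq_bigr => j _; rewrite -map_linf. Qed.

Lemma map_star_form L g :
  map_mpoly f (star_form L g) = star_form (fun j => f \o L j) (fun i => map_mpoly f (g i)).
Proof.
by rewrite rmorph_sum; apply: eq_bigr => i _; rewrite rmorphM /= map_prod_but1.
Qed.

End Naturality.

(** The affine chart of projective space in which coordinate [x] is 1. *)
Definition norm_vec (R : pzRingType) n (x : 'I_n.+1) (w : 'I_n -> R) : 'I_n.+1 -> R :=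
  fun r => if unlift x r is Some s then w s else 1.

Lemma norm_vecP (k : fieldType) n (x : 'I_n.+1) (a : 'I_n.+1 -> k) r : a x != 0 ->
  a r = a x * norm_vec x (fun s => a (lift x s) / a x) r.
Proof.
move=> ax; rewrite /norm_vec; case: unliftP => [s ->|->]; last by rewrite mulr1.
by rewrite mulrC divfK.
Qed.

Definition gen_sum (R : comNzRingType) e r (sel : 'I_r -> 'I_6 * 'I_#|{: mon e}|)
    (L : 'I_6 -> 'I_3 -> R) (c : 'I_r -> R) : {mpoly R[3]} :=
  \sum_j c j *: ('X_[mon_of (sel j).2] * prod_but1 L (sel j).1).

Lemma map_gen_sum (R S : comNzRingType) (f : {rmorphism R -> S}) e r sel L c :
  map_mpoly f (@gen_sum R e r sel L c) = gen_sum sel (fun i => f \o L i) (f \o c).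
Proof.
rewrite rmorph_sum; apply: eq_bigr => j _.
by rewrite /= map_mpolyZ rmorphM /= map_mpolyX map_prod_but1.
Qed.

Lemma eq_gen_sum (R : comNzRingType) e r sel L L' (c c' : 'I_r -> R) :
  (forall i, L i =1 L' i) -> c =1 c' -> @gen_sum R e r sel L c = gen_sum sel L' c'.
Proof.
move=> eL ec; apply: eq_bigr => j _; rewrite ec; congr (_ *: (_ * _)).
by apply: eq_bigr => i _; apply: eq_linf.
Qed.

Lemma prod_but1_scale (R : comNzRingType) (L L' : 'I_6 -> 'I_3 -> R) (lam : 'I_6 -> R) i :
  (forall j r, L j r = lam j * L' j r) ->
  prod_but1 L i = (\prod_(j | j != i) lam j) *: prod_but1 L' i.
Proof.
move=> LE; rewrite -scaler_prod; apply: eq_bigr => j _.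
by rewrite -linfZ; apply: eq_linf.
Qed.

Section UpperBound.
Variables (k : closedFieldType) (e : nat).
Local Notation d := (e.+1 + 4)%N.
Local Notation N := #|{: mon d}|.
Local Notation M := #|{: mon e}|.

(** Ensures that the subtractions [N - 15], [N - 16] and [N - 4] are not truncated. *)
Lemma card_mon_ge21 : (21 <= N)%N.
Proof. by rewrite card_mon (leq_bin2l 2 (_ : 7 <= d.+2)%N) //; lia. Qed.

Local Notation r := (N - 16)%N.
Local Notation P := (('I_6 * 'I_2) + 'I_r)%type.

Lemma card_param : #|{: P}| = (N - 4)%N.
Proof. rewrite card_sum card_prod !card_ord; have := card_mon_ge21; lia. Qed.

Definition chart_lines (R : comNzRingType) (x : 'I_6 -> 'I_3) (w : P -> R) i : 'I_3 -> R :=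
  norm_vec (x i) (fun s => w (inl (i, s))).
Definition chart_coefs (R : comNzRingType) (b : 'I_r.+1) (w : P -> R) : 'I_r.+1 -> R :=
  norm_vec b (fun s => w (inr s)).

(** A chart records which coordinate of each line is set to 1, which [N - 15] generators are used,
    and which of their coefficients is set to 1. *)
Local Notation chart := ({ffun 'I_6 -> 'I_3} * {ffun 'I_r.+1 -> 'I_6 * 'I_M} * 'I_r.+1)%type.

(** The ring is arbitrary so that variables for [w] give the chart map and scalars give its
    values. *)
Definition chart_form (R : comNzRingType) (x : chart) (w : P -> R) : {mpoly R[3]} :=
  gen_sum x.1.2 (chart_lines x.1.1 w) (chart_coefs x.2 w).

Lemma map_chart_form (R S : comNzRingType) (f : {rmorphism R -> S}) x w :
  map_mpoly f (@chart_form R x w) = chart_form x (f \o w).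
Proof.
rewrite map_gen_sum; apply: eq_gen_sum => [i s|s] /=.
  by rewrite /chart_lines /norm_vec; case: unlift => //; rewrite rmorph1.
by rewrite /chart_coefs /norm_vec; case: unlift => //; rewrite rmorph1.
Qed.

Definition chart_map (x : chart) : N.-tuple {mpoly k[#|{: P}|]} :=
  [tuple (chart_form x (fun s => 'X_(enum_rank s) : {mpoly k[#|{: P}|]}))@_(mon_of j) | j < N].

Lemma meval_chart_map x w j :
  (tnth (chart_map x) j).@[w] = (chart_form x (w \o enum_rank))@_(mon_of j).
Proof.
rewrite tnth_mktuple -mcoeff_map_mpoly map_chart_form; congr (_@__).
by apply: eq_gen_sum => [i s|s]; rewrite /= /chart_lines /chart_coefs /norm_vec;
  case: unlift => //= a; rewrite mevalXU.
Qed.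

(** The scalars that normalise the lines move into the coefficients; dividing by a nonzero
    coefficient leaves the factor [c]. *)
Lemma chart_cover (L : 'I_6 -> 'I_3 -> k) p : no_concurrent L -> star_ideal L e.+1 p -> p != 0 ->
  exists (x : chart) c w, p = c *: chart_form x w.
Proof.
move=> nc pL p0.
have N21 := card_mon_ge21.
have Er : r.+1 = (N - 15)%N by lia.
have nzL i : exists s, L i s != 0 by case: (no_concurrent_in_D nc) => h _ _; apply: h.
have [y hy] := fin_all_exists nzL.
have M0 : (0 < M)%N by rewrite card_mon bin_gt0.
have [sel [c pE]] : exists (sel : 'I_r.+1 -> 'I_6 * 'I_M) (c : 'I_r.+1 -> k),
    p = gen_sum sel L c.
  have := rank_star_mx e nc; rewrite -Er => rk.
  have [sel [c cE]] := select_rows (enum_rank (ord0, Ordinal M0)) rk (cvec_star_ideal pL).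
  exists (fun j => enum_val (sel j)), (c 0).
  rewrite -(cvecK (star_ideal_dhomog pL)) cE linear_sum; apply: eq_bigr => j _.
  by rewrite rowK linearZ /= cvecK ?dhomog_star_gen.
pose L' i := norm_vec (y i) (fun s => L i (lift (y i) s) / L i (y i)).
have LE i s : L i s = L i (y i) * L' i s by apply: norm_vecP.
pose c' j := c j * \prod_(i | i != (sel j).1) L i (y i).
have pE' : p = gen_sum sel L' c'.
  rewrite pE; apply: eq_bigr => j _.
  by rewrite (prod_but1_scale _ LE) -scalerAr scalerA.
have [b cb] : exists b, c' b != 0.
  apply: NNPP => nb; case/eqP: p0; rewrite pE' /gen_sum big1 // => j _.
  have [->|cj] := eqVneq (c' j) 0; first by rewrite scale0r.
  by case: nb; exists j.
exists ([ffun i => y i], [ffun j => sel j], b), (c' b).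
exists (fun s => match s with
  | inl u => L u.1 (lift (y u.1) u.2) / L u.1 (y u.1)
  | inr u => c' (lift b u) / c' b end).
rewrite pE' /chart_form /gen_sum scaler_sumr; apply: eq_bigr => j _.
rewrite scalerA ffunE /chart_coefs -norm_vecP //; congr (_ *: (_ * _)).
by apply: eq_bigr => i _; apply: eq_linf => s; rewrite /chart_lines /L' ffunE.
Qed.

Lemma no_chain_Sdl : ~ has_chain (zclosure (@Sdl k d 6)) (N - 4).+1.
Proof.
rewrite -card_param; apply: (no_chain_of_charts (phi := chart_map)) => v.
case=> [p [L [p0 hp inD star vE]]].
have nc := in_D_no_concurrent inD.
have pL : star_ideal L e.+1 p.
  apply: star_idealP => // q; have qn := pair6_neq q; apply: star.
  split; first exact: nzvec_vertex.
  exists (val q).1, (val q).2; split=> //; split; first exact: dot3_crossl.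
  exact: dot3_crossr.
have [x [c [w pE]]] := chart_cover nc pL p0.
exists x, c, (w \o enum_val) => j.
rewrite vE meval_chart_map /coords -/(mon_of j) pE mcoeffZ; congr (_ * _).
congr (_@__); apply: eq_gen_sum => [i s|s] /=; rewrite /chart_lines /chart_coefs /norm_vec;
  by case: unlift => //= a; rewrite enum_rankK.
Qed.

End UpperBound.

(** * Second order expansion of a family of star forms *)

Notation "''o_' n" := (@Ordinal 6 n isT) (at level 8, n at level 2, format "''o_' n").

Lemma big6E (R : Type) (idx : R) (op : Monoid.law idx) (P : pred 'I_6) (F : 'I_6 -> R) :
  \big[op/idx]_(i | P i) F i =
  op (if P 'o_0 then F 'o_0 else idx) (op (if P 'o_1 then F 'o_1 else idx)
  (op (if P 'o_2 then F 'o_2 else idx) (op (if P 'o_3 then F 'o_3 else idx)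
  (op (if P 'o_4 then F 'o_4 else idx) (if P 'o_5 then F 'o_5 else idx))))).
Proof.
rewrite big_mkcond !big_ord_recl big_ord0 Monoid.mulm1.
by do !congr (op _ _); do ?[congr (if P _ then F _ else _)]; apply/val_inj.
Qed.

Section Expansion.
Variable R : comNzRingType.
Implicit Types (A b c : 'I_6 -> R) (M H T : R).

(** For constant [c = 1], [S1] is the elementary symmetric polynomial [e_5]; [S2] is the derivative
    of [e_5] in direction [b], and [S3] is [e_3]. *)
Definition S1 A c := \sum_i c i * \prod_(j | j != i) A j.
Definition S2 A b := \sum_j b j * \sum_(i | i != j) \prod_(r | (r != i) && (r != j)) A r.
Definition S3 A := \sum_(i < 6) \sum_(j < 6 | (i < j)%N) \sum_(l < 6 | (j < l)%N) A i * A j * A l.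

Definition trunc3 T a a0 a1 a2 := exists r, a = a0 + T * a1 + T ^+ 2 * a2 + T ^+ 3 * r.

Lemma trunc3D T x x0 x1 x2 y y0 y1 y2 : trunc3 T x x0 x1 x2 -> trunc3 T y y0 y1 y2 ->
  trunc3 T (x + y) (x0 + y0) (x1 + y1) (x2 + y2).
Proof. by move=> [r ->] [s ->]; exists (r + s); ring. Qed.

Lemma trunc3M T x x0 x1 x2 y y0 y1 y2 : trunc3 T x x0 x1 x2 -> trunc3 T y y0 y1 y2 ->
  trunc3 T (x * y) (x0 * y0) (x0 * y1 + x1 * y0) (x0 * y2 + x1 * y1 + x2 * y0).
Proof.
move=> [r ->] [s ->].
exists (x0 * s + y0 * r + x1 * y2 + x2 * y1 + T * (x1 * s + y1 * r + x2 * y2)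
  + T ^+ 2 * (x2 * s + y2 * r) + T ^+ 3 * r * s); ring.
Qed.

(** A common shift gives [e_5(A + x) = e_5 + 2 e_4 x + 3 e_3 x^2 + ...], whence the factors 2 and 3;
    the individual moves [b] and [c] enter at second order only. *)
Lemma star_expansion A b c M H T :
  exists s, trunc3 T (S1 (fun j => A j + T * M + T ^+ 2 * b j) (fun i => H + T ^+ 2 * c i))
    (H * S1 A (fun=> 1)) (M *+ 2 * s) (S1 A c + H * S2 A b + H * M ^+ 2 * (3%:R * S3 A)).
Proof.
have hl j : trunc3 T (A j + T * M + T ^+ 2 * b j) (A j) M (b j).
  by exists 0; rewrite mulr0 addr0.
have hg i : trunc3 T (H + T ^+ 2 * c i) H 0 (c i) by exists 0; rewrite !mulr0 !addr0.
pose S4 := \sum_(i < 6) \sum_(j < 6 | (i < j)%N) \prod_(r | (r != i) && (r != j)) A r.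
exists (H * S4).
have conv x x0 x1 x2 y0 y1 y2 : trunc3 T x x0 x1 x2 ->
    [/\ x0 = y0, x1 = y1 & x2 = y2] -> trunc3 T x y0 y1 y2 by move=> h [<- <- <-].
rewrite /S1 /S2 /S3 /S4 !big6E /= !mul1r !mulr1 !add0r !addr0.
eapply conv.
  by repeat first [eapply hl | eapply hg | eapply trunc3M | eapply trunc3D].
split; ring.
Qed.

End Expansion.

Lemma sqr_sum_double0 (R : comNzRingType) m (x : 'I_m -> R) :
  (forall a, x a *+ 2 = 0) -> (\sum_a x a) ^+ 2 = \sum_a x a ^+ 2.
Proof.
move=> x2; apply: (big_rec2 (fun s t => s ^+ 2 = t)) => [|a s t _ <-]; first by rewrite expr0n.
by rewrite sqrrD -mulrnAl x2 mul0r addr0.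
Qed.

(** This is [dot3 c (cross a b)] over any commutative ring, as needed for lines depending on
    parameters. *)
Definition det3 (R : comNzRingType) (a b c : 'I_3 -> R) :=
  \sum_r c r * (a (ordS r) * b (ord_pred r) - a (ord_pred r) * b (ordS r)).

Lemma rmorph_det3 (R S : comNzRingType) (f : {rmorphism R -> S}) a b c :
  f (det3 a b c) = det3 (f \o a) (f \o b) (f \o c).
Proof.
by rewrite rmorph_sum; apply: eq_bigr => r _; rewrite /= rmorphM rmorphB !rmorphM.
Qed.

Lemma eq_det3 (R : comNzRingType) (a b c a' b' c' : 'I_3 -> R) :
  a =1 a' -> b =1 b' -> c =1 c' -> det3 a b c = det3 a' b' c'.
Proof. by move=> ea eb ec; apply: eq_bigr => r _; rewrite !ea !eb !ec. Qed.

Lemma linf_sum (R : comNzRingType) m (x : 'I_m -> R) (y : 'I_m -> 'I_3 -> R) :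
  linf (fun r => \sum_a x a * y a r) = \sum_a x a *: linf (y a).
Proof.
rewrite /linf; under eq_bigr => r _ do rewrite scaler_suml.
rewrite exchange_big; apply: eq_bigr => a _; rewrite scaler_sumr.
by apply: eq_bigr => r _; rewrite scalerA.
Qed.

Definition expansion2 (R : comNzRingType) (A c b : 'I_6 -> R) (M H : R) :=
  S1 A c + H * S2 A b + H * M ^+ 2 * (3%:R * S3 A).

Section ExpansionMorphism.
Variables (R S : comNzRingType) (f : {rmorphism R -> S}).

Lemma rmorph_S1 A c : f (S1 A c) = S1 (f \o A) (f \o c).
Proof.
by rewrite rmorph_sum; apply: eq_bigr => i _; rewrite rmorphM rmorph_prod.
Qed.

Lemma rmorph_S2 A b : f (S2 A b) = S2 (f \o A) (f \o b).
Proof.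
rewrite rmorph_sum; apply: eq_bigr => i _; rewrite rmorphM rmorph_sum; congr (_ * _).
by apply: eq_bigr => j _; rewrite rmorph_prod.
Qed.

Lemma rmorph_S3 A : f (S3 A) = S3 (f \o A).
Proof.
rewrite rmorph_sum; apply: eq_bigr => i _; rewrite rmorph_sum; apply: eq_bigr => j _.
by rewrite rmorph_sum; apply: eq_bigr => l _; rewrite !rmorphM.
Qed.

Lemma rmorph_expansion2 A c b M H :
  f (expansion2 A c b M H) = expansion2 (f \o A) (f \o c) (f \o b) (f M) (f H).
Proof.
rewrite rmorphD rmorphD rmorph_S1; congr (_ + _ + _); first by rewrite rmorphM rmorph_S2.
by rewrite rmorphM rmorphM rmorphXn rmorphM rmorph_nat rmorph_S3.
Qed.

End ExpansionMorphism.

Section ExpansionLinear.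
Variables (R : comNzRingType) (V : comAlgType R) (A : 'I_6 -> V) (m : nat).

Lemma S1_sum (x : 'I_m -> R) (c : 'I_m -> 'I_6 -> V) :
  S1 A (fun i => \sum_a x a *: c a i) = \sum_a x a *: S1 A (c a).
Proof.
rewrite /S1; under eq_bigr => i _ do rewrite mulr_suml.
rewrite exchange_big; apply: eq_bigr => a _; rewrite scaler_sumr.
by apply: eq_bigr => i _; rewrite scalerAl.
Qed.

Lemma S2_sum (x : 'I_m -> R) (b : 'I_m -> 'I_6 -> V) :
  S2 A (fun i => \sum_a x a *: b a i) = \sum_a x a *: S2 A (b a).
Proof.
rewrite /S2; under eq_bigr => i _ do rewrite mulr_suml.
rewrite exchange_big; apply: eq_bigr => a _; rewrite scaler_sumr.
by apply: eq_bigr => i _; rewrite scalerAl.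
Qed.

Lemma sum_scale_distr (x : 'I_m -> R) (p q r : 'I_m -> V) (H s : V) :
  \sum_a x a *: p a + H * (\sum_a x a *: q a) + H * (\sum_a x a *: r a) * s =
  \sum_a x a *: (p a + H * q a + H * r a * s).
Proof.
rewrite !mulr_sumr mulr_suml -!big_split; apply: eq_bigr => a _.
by rewrite /= -!scalerAr -scalerAl -!scalerDr.
Qed.

End ExpansionLinear.

(** * A family of star curves through a base point *)

Section Family.
Variables (k : closedFieldType) (e : nat).
Local Notation d := (e.+1 + 4)%N.
Local Notation N := #|{: mon d}|.
Variables (L0 : 'I_6 -> 'I_3 -> k) (h : 'I_3 -> k) (m : nat).
Variables (C : 'I_m -> 'I_6 -> {mpoly k[3]}) (B : 'I_m -> 'I_6 -> 'I_3 -> k).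
Variable (Mv : 'I_m -> 'I_3 -> k).

(** All lines share the term linear in [z], while their individual moves [B] are quadratic; [f]
    carries constants into the ring of parameters. *)
Definition famL (R : comNzRingType) (f : k -> R) (z : 'I_m -> R) i r :=
  f (L0 i r) + \sum_a z a * f (Mv a r) + \sum_a z a ^+ 2 * f (B a i r).
Definition famG (R : comNzRingType) (f : k -> R) (z : 'I_m -> R) i :=
  map_mpoly f (linf h ^+ e) + \sum_a z a ^+ 2 *: map_mpoly f (C a i).
Definition fam (R : comNzRingType) (f : k -> R) (z : 'I_m -> R) :=
  star_form (famL f z) (famG f z).

Definition base_form := linf h ^+ e * S1 (fun j => linf (L0 j)) (fun=> 1).
Definition direction_form a := expansion2 (fun j => linf (L0 j)) (C a)
  (fun j => linf (B a j)) (linf (Mv a)) (linf h ^+ e).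

Lemma rmorph_famL (R S : comNzRingType) (g : {rmorphism R -> S}) (f : k -> R) (f' : k -> S) z i r :
  (forall c, g (f c) = f' c) -> g (famL f z i r) = famL f' (g \o z) i r.
Proof.
move=> gf; rewrite /famL !rmorphD !rmorph_sum gf /=; congr (_ + _ + _).
  by apply: eq_bigr => a _; rewrite rmorphM gf.
by apply: eq_bigr => a _; rewrite rmorphM rmorphXn gf.
Qed.

Lemma map_fam (R S : comNzRingType) (g : {rmorphism R -> S}) (f : {rmorphism k -> R})
    (f' : {rmorphism k -> S}) z :
  (forall c, g (f c) = f' c) -> map_mpoly g (fam f z) = fam f' (g \o z).
Proof.
move=> gf; rewrite map_star_form.
have gfp (p : {mpoly k[3]}) : map_mpoly g (map_mpoly f p) = map_mpoly f' p.
  by apply/mpolyP => u; rewrite !mcoeff_map_mpoly /= gf.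
apply: eq_bigr => i _; congr (_ * _).
  rewrite /famG rmorphD /= gfp; congr (_ + _); rewrite rmorph_sum; apply: eq_bigr => a _.
  by rewrite /= map_mpolyZ gfp rmorphXn.
by apply: eq_bigr => j _; apply: eq_linf => r; apply: rmorph_famL.
Qed.

Definition fam_map : N.-tuple {mpoly k[m]} :=
  [tuple (fam (@mpolyC m k) (fun a => 'X_a))@_(mon_of j) | j < N].

Lemma eq_fam (R : comNzRingType) (f : k -> R) z z' : z =1 z' -> fam f z = fam f z'.
Proof.
move=> ez; apply: eq_bigr => i _; congr (_ * _).
  by rewrite /famG; congr (_ + _); apply: eq_bigr => a _; rewrite ez.
by apply: eq_bigr => j _; apply: eq_linf => r; congr (_ + _ + _); apply: eq_bigr => a _;
  rewrite ez.
Qed.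

Lemma meval_fam_map z j : (tnth fam_map j).@[z] = (fam idfun z)@_(mon_of j).
Proof.
rewrite tnth_mktuple -mcoeff_map_mpoly (map_fam (f' := idfun)).
  by congr (_@__); apply: eq_fam => a; rewrite /= mevalXU.
by move=> c; rewrite /= mevalC.
Qed.

Hypothesis nc0 : no_concurrent L0.
Hypothesis hC : forall a i, C a i \is e.-homog.
Hypothesis Mv2 : forall a r, Mv a r *+ 2 = 0.
Hypothesis freeD : row_free (col_mx (cvec d base_form) (\matrix_a cvec d (direction_form a))).

Lemma map_mpoly_idfun (p : {mpoly k[3]}) : map_mpoly idfun p = p.
Proof. by apply/mpolyP => u; rewrite mcoeff_map_mpoly. Qed.

Lemma dhomog_fam z : fam idfun z \is d.-homog.
Proof.
rewrite addSnnS; apply: dhomog_star_form => i; rewrite /famG map_mpoly_idfun.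
apply: dhomogD; first exact: dhomog_linfX.
by apply: dhomog_suml => a _; apply: dhomogZ; rewrite map_mpoly_idfun.
Qed.

Lemma fam_in_Sdl z : no_concurrent (famL idfun z) ->
  nzvec (fun j => (tnth fam_map j).@[z]) ->
  @Sdl k d 6 (fun j => (tnth fam_map j).@[z]).
Proof.
move=> nc [j nz]; exists (fam idfun z), (famL idfun z); split.
- by apply: contraNneq nz; rewrite meval_fam_map => ->; rewrite mcoeff0.
- exact: dhomog_fam.
- exact: no_concurrent_in_D.
- exact: contains_star_form.
by move=> i; rewrite meval_fam_map.
Qed.

(** Scaling [z] by an indeterminate brings the family under [star_expansion]. The first order term
    carries a factor 2, which kills [Mv]; the mixed products [z_a z_b] in the square of the shift
    disappear for the same reason. *)
Lemma base_form_expansion (z : 'I_m -> k) : exists R : 'I_N -> {poly k}, forall t j,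
  (tnth fam_map j).@[fun a => t * z a] =
  cvec d base_form 0 j + t ^+ 2 * (\sum_a z a ^+ 2 * (\matrix_a cvec d (direction_form a)) a j) +
  t ^+ 3 * (R j).[t].
Proof.
pose up (p : {mpoly k[3]}) := map_mpoly (@polyC k) p.
pose T : {mpoly {poly k}[3]} := 'X%:MP.
have [s [r E]] := star_expansion (fun j => up (linf (L0 j)))
  (fun j => \sum_a (z a ^+ 2)%:P *: up (linf (B a j)))
  (fun i => \sum_a (z a ^+ 2)%:P *: up (C a i))
  (\sum_a (z a)%:P *: up (linf (Mv a))) (up (linf h ^+ e)) T.
exists (fun j => r@_(mon_of j)) => t j.
have T1 p : T * p = 'X *: p by rewrite mul_mpolyC.
have T2 p : T ^+ 2 * p = 'X^2 *: p by rewrite /T expr2 -mpolyCM mul_mpolyC -expr2.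
have upM2 a : ((z a)%:P *: up (linf (Mv a))) *+ 2 = 0.
  have -> : up (linf (Mv a)) = linf (fun r => (Mv a r)%:P).
    by rewrite /up map_linf.
  rewrite scalerMnr /linf -sumrMnl big1 ?scaler0 // => i _.
  by rewrite scalerMnl -polyCMn Mv2 scale0r.
have M2 : (\sum_a (z a)%:P *: up (linf (Mv a))) *+ 2 = 0.
  by rewrite -sumrMnl big1.
have E' : fam (@polyC k) (fun a => z a *: 'X) =
    up base_form + T ^+ 2 * up (\sum_a z a ^+ 2 *: direction_form a) + T ^+ 3 * r.
  have -> : fam (@polyC k) (fun a => z a *: 'X) =
     S1 (fun j => up (linf (L0 j)) + T * (\sum_a (z a)%:P *: up (linf (Mv a))) +
        T ^+ 2 * (\sum_a (z a ^+ 2)%:P *: up (linf (B a j))))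
      (fun i => up (linf h ^+ e) + T ^+ 2 * (\sum_a (z a ^+ 2)%:P *: up (C a i))).
    apply: eq_bigr => i _; congr (_ * _).
      rewrite /famG mulr_sumr; congr (_ + _); apply: eq_bigr => a _.
      by rewrite T2 scalerA exprZn -mul_polyC mulrC.
    apply: eq_bigr => l _; rewrite /famL !linfD !linf_sum /up map_linf T1 T2.
    rewrite !scaler_sumr; congr (_ + _ + _); apply: eq_bigr => a _; rewrite map_linf scalerA.
      by rewrite -mul_polyC mulrC.
    by rewrite exprZn -mul_polyC mulrC.
  rewrite E M2 mul0r mulr0 addr0; congr (_ + _ * _ + _).
    rewrite /up /base_form [RHS]rmorphM rmorph_S1; congr (_ * _).
    by apply: eq_bigr => i _; rewrite /= rmorph1.
  rewrite S1_sum S2_sum (sqr_sum_double0 upM2).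
  under [X in _ * X * _]eq_bigr => a _ do rewrite exprZn -rmorphXn.
  rewrite sum_scale_distr /up rmorph_sum; apply: eq_bigr => a _.
  by rewrite /= map_mpolyZ (rmorph_expansion2 (map_mpoly (@polyC k))).
have -> : (tnth fam_map j).@[fun a => t * z a] =
    ((fam (@polyC k) (fun a => z a *: 'X))@_(mon_of j)).[t].
  rewrite meval_fam_map -/(horner_eval t _) -mcoeff_map_mpoly (map_fam (f' := idfun)).
    by congr (_@__); apply: eq_fam => a; rewrite /= /horner_eval hornerZ hornerX mulrC.
  by move=> c; rewrite /= /horner_eval hornerC.
rewrite E' !mcoeffD !hornerD T2 mcoeffZ hornerM hornerXn mxE /coords -/(mon_of j).
rewrite /up !mcoeff_map_mpoly /= !hornerC; congr (_ + _ * _ + _).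
  by rewrite raddf_sum; apply: eq_bigr => a _; rewrite /= mcoeffZ !mxE.
have -> : T ^+ 3 * r = 'X^3 *: r by rewrite exprS -mulrA T2 T1 scalerA -exprS.
by rewrite mcoeffZ hornerM hornerXn.
Qed.

(** The product of the determinants of all triples is nonzero at [z = 0], where the lines are
    [L0]. *)
Lemma fam_nonconcurrent_poly : exists del : {mpoly k[m]},
  del != 0 /\ forall z, del.@[z] != 0 -> no_concurrent (famL idfun z).
Proof.
pose Lh := famL (@mpolyC m k) (fun a => 'X_a).
pose Tr := {u : 'I_6 * 'I_6 * 'I_6 | [&& u.1.1 != u.1.2, u.1.2 != u.2 & u.1.1 != u.2]}.
exists (\prod_(u : Tr) det3 (Lh (val u).1.1) (Lh (val u).1.2) (Lh (val u).2)).
have ev z i j l : (det3 (Lh i) (Lh j) (Lh l)).@[z] =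
    dot3 (famL idfun z l) (vertex (famL idfun z) i j).
  have ev1 t s : (Lh t s).@[z] = famL idfun z t s.
    rewrite (rmorph_famL (f' := idfun)) => [|c]; last exact: mevalC.
    by congr (_ + _ + _); apply: eq_bigr => a _; rewrite /= mevalXU.
  by rewrite rmorph_det3; apply: eq_det3 => s; apply: ev1.
have L00 i s : famL idfun (fun=> 0) i s = L0 i s.
  rewrite /famL big1 => [|a _]; last exact: mul0r.
  by rewrite big1 ?addr0 // => a _; rewrite expr0n mul0r.
split=> [|z].
  apply/prodf_neq0 => -[[[i j] l] /= /and3P [ij jl il]] _.
  have : (det3 (Lh i) (Lh j) (Lh l)).@[fun=> 0] != 0.
    rewrite ev; have := nc0 ij jl il; rewrite /dot3 /vertex /cross.
    by under eq_bigr => s _ do rewrite -!L00.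
  by apply: contraNneq => ->; rewrite meval0.
rewrite rmorph_prod /= => /prodf_neq0 hz i j l ij jl il.
have u0 : [&& i != j, j != l & i != l] by rewrite ij jl il.
by have := hz (exist _ (i, j, l) u0 : Tr) isT; rewrite /= ev.
Qed.

Lemma chain_of_directions : has_chain (zclosure (@Sdl k d 6)) m.
Proof.
apply: (chain_of_family (phi := fam_map) _ freeD base_form_expansion) => z nz.
split=> // f [[n hf] fS].
have [del [del0 delP]] := fam_nonconcurrent_poly.
have Sz w : del.@[w] != 0 -> f.@[fun j => (tnth fam_map j).@[w]] = 0 \/
    forall j, (tnth fam_map j).@[w] = 0.
  move=> /delP nc; have [nzw|nzw] := classic (nzvec (fun j => (tnth fam_map j).@[w])).
    by left; apply: fS; apply: fam_in_Sdl.
  by right=> j; apply: NNPP => h'; apply: nzw; exists j; apply/eqP.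
have [j0 zj0] := nz.
have t0 : tnth fam_map j0 != 0 by apply: contraNneq zj0 => ->; rewrite meval0.
(* The factor [del] disposes of parameters with concurrent lines, and a coordinate of the map of
   those giving the zero vector. Both are nonzero polynomials, so [f] vanishes on the whole
   family. *)
have : (f \mPo fam_map) * (del * tnth fam_map j0) = 0.
  apply: mpoly_eq0_meval => w; rewrite !mevalM comp_mpoly_meval.
  have [->|dw] := eqVneq del.@[w] 0; first by rewrite mul0r mulr0.
  by case: (Sz w dw) => ->; rewrite ?mul0r ?mulr0.
move/eqP; rewrite !mulf_eq0 (negPf del0) (negPf t0) !orbF => /eqP f0.
by rewrite -comp_mpoly_meval f0 meval0.
Qed.

End Family.

(** * An explicit star configuration and its balanced weights *)

Notation "''p_' n" := (@Ordinal 3 n isT) (at level 8, n at level 2, format "''p_' n").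

Lemma sum_pair6 (V : nmodType) (F : 'I_6 -> 'I_6 -> V) :
  \sum_(q : pair6) F (val q).1 (val q).2 = \sum_(i < 6) \sum_(j < 6 | (i < j)%N) F i j.
Proof.
rewrite (pair_big_dep xpredT (fun i j : 'I_6 => (i < j)%N)) /=.
rewrite -[LHS](big_sub (fun q : 'I_6 * 'I_6 => (q.1 < q.2)%N) (fun q => F q.1 q.2)).
exact: eq_bigl.
Qed.

Section ExplicitPlane.
Variable k : closedFieldType.

Lemma dot3E (a u : 'I_3 -> k) : dot3 a u = a 'p_0 * u 'p_0 + a 'p_1 * u 'p_1 + a 'p_2 * u 'p_2.
Proof.
rewrite /dot3 (sum3E _ 'p_0).
by congr (a _ * u _ + a _ * u _ + a _ * u _); apply/val_inj.
Qed.

Lemma crossE (a b : 'I_3 -> k) :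
  [/\ cross a b 'p_0 = a 'p_1 * b 'p_2 - a 'p_2 * b 'p_1,
      cross a b 'p_1 = a 'p_2 * b 'p_0 - a 'p_0 * b 'p_2 &
      cross a b 'p_2 = a 'p_0 * b 'p_1 - a 'p_1 * b 'p_0].
Proof.
split; rewrite /cross; congr (a _ * b _ - a _ * b _); exact/val_inj.
Qed.

Lemma dot3_crossE (a b u : 'I_3 -> k) : dot3 u (cross a b) =
  u 'p_0 * (a 'p_1 * b 'p_2 - a 'p_2 * b 'p_1) +
  u 'p_1 * (a 'p_2 * b 'p_0 - a 'p_0 * b 'p_2) +
  u 'p_2 * (a 'p_0 * b 'p_1 - a 'p_1 * b 'p_0).
Proof. by rewrite dot3E; case: (crossE a b) => -> -> ->. Qed.

Lemma no_concurrent_sorted (L : 'I_6 -> 'I_3 -> k) :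
  (forall i j m : 'I_6, (i < j)%N -> (j < m)%N -> dot3 (L m) (vertex L i j) != 0) ->
  no_concurrent L.
Proof.
rewrite /vertex => h i j m ij jm im.
have rot x y z : dot3 (L z) (cross (L x) (L y)) = dot3 (L x) (cross (L y) (L z)).
  exact: dot3_cross_rot.
have sw x y z : (dot3 (L z) (cross (L x) (L y)) != 0) = (dot3 (L z) (cross (L y) (L x)) != 0).
  by rewrite (dot3_crossC (L y)) oppr_eq0.
wlog ltij : i j ij jm im / (i < j)%N.
  case: (ltngtP i j) => [lt|lt|/val_inj e] hw; [exact: hw | | by rewrite e eqxx in ij].
  by rewrite sw; apply: hw; rewrite // eq_sym.
case: (ltngtP j m) => [ltjm|ltmj|/val_inj e]; [exact: h | | by rewrite e eqxx in jm].
case: (ltngtP i m) => [ltim|ltmi|/val_inj e]; [ | | by rewrite e eqxx in im].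
  by rewrite sw rot; apply: h.
by rewrite -rot; apply: h.
Qed.

Definition lines6 (s : k) (i : 'I_6) (r : 'I_3) : k :=
  nth 0 (nth [::] [:: [:: 1; 0; 0]; [:: 0; 1; 0]; [:: 0; 0; 1];
    [:: 1; 1; 1]; [:: 1; s; s ^+ 2]; [:: 1; s ^+ 2; s ^+ 4]] i) r.

Variable s : k.
Hypothesis s0 : s != 0.
Hypothesis s4 : s ^+ 4 != 1.

Lemma sub1_neq0 : [/\ s - 1 != 0, s + 1 != 0 & s ^+ 2 + 1 != 0].
Proof.
have : (s - 1) * (s + 1) * (s ^+ 2 + 1) != 0.
  by rewrite (_ : _ * _ = s ^+ 4 - 1) ?subr_eq0 //; ring.
by rewrite !mulf_eq0 !negb_or => /andP [/andP [-> ->] ->].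
Qed.

(** Up to sign each of the 20 determinants is a product of powers of [s], [s - 1], [s + 1] and
    [s^2 + 1]; the numerals in the proof are the exponents. *)
Lemma no_concurrent_lines6 : no_concurrent (lines6 s).
Proof.
have [n1 n2 n3] := sub1_neq0.
have pos x a b c d : x = s ^+ a * (s - 1) ^+ b * (s + 1) ^+ c * (s ^+ 2 + 1) ^+ d -> x != 0.
  by move=> ->; rewrite !mulf_neq0 ?expf_neq0.
have neg x a b c d : x = - (s ^+ a * (s - 1) ^+ b * (s + 1) ^+ c * (s ^+ 2 + 1) ^+ d) -> x != 0.
  by move=> ->; rewrite oppr_eq0 !mulf_neq0 ?expf_neq0.
apply: no_concurrent_sorted; rewrite /vertex.
do 3!(case=> -[|[|[|[|[|[|?]]]]]] // ?); move=> // _ _;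
  rewrite dot3_crossE /lines6 /=.
- by apply: (pos _ 0 0 0 0); ring.
- by apply: (pos _ 0 0 0 0); ring.
- by apply: (pos _ 2 0 0 0); ring.
- by apply: (pos _ 4 0 0 0); ring.
- by apply: (neg _ 0 0 0 0); ring.
- by apply: (neg _ 1 0 0 0); ring.
- by apply: (neg _ 2 0 0 0); ring.
- by apply: (pos _ 1 1 0 0); ring.
- by apply: (pos _ 2 1 1 0); ring.
- by apply: (pos _ 4 1 0 0); ring.
- by apply: (pos _ 0 0 0 0); ring.
- by apply: (pos _ 0 0 0 0); ring.
- by apply: (pos _ 0 0 0 0); ring.
- by apply: (neg _ 0 1 1 0); ring.
- by apply: (neg _ 0 1 1 1); ring.
- by apply: (neg _ 2 1 1 0); ring.
- by apply: (pos _ 0 1 0 0); ring.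
- by apply: (pos _ 0 1 1 0); ring.
- by apply: (pos _ 1 1 0 0); ring.
- by apply: (pos _ 1 3 1 0); ring.
Qed.

End ExplicitPlane.

Lemma eq_of_relation (R : comNzRingType) (c x y z : R) : z = 0 -> x - y = c * z -> x = y.
Proof. by move=> -> /eqP; rewrite mulr0 subr_eq0 => /eqP. Qed.

Section Stresses.
Variables (k : closedFieldType) (s : k) (W : 'I_6 -> 'I_6 -> k).
Local Notation L := (lines6 s).
Hypothesis balanced : forall (j : 'I_6) r,
  \sum_(l < 6 | (j < l)%N) W j l * vertex L j l r +
  \sum_(i < 6 | (i < j)%N) W i j * vertex L i j r = 0.
Hypothesis W34 : W 'o_3 'o_4 = 0.
Hypothesis W35 : W 'o_3 'o_5 = 0.
Hypothesis W45 : W 'o_4 'o_5 = 0.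
Local Notation w3 := (W 'o_0 'o_3).
Local Notation w4 := (W 'o_0 'o_4).
Local Notation w5 := (W 'o_0 'o_5).

(** Each of the last three lines carries only its vertices with the triangle, and its balance leaves
    one free weight. A vertex of the triangle lies on two lines: balance on one expresses its weight
    by the free ones, balance on the other gives the opposite of the same expression. *)
Lemma stress_relations :
  [/\ [/\ W 'o_1 'o_3 = w3, W 'o_1 'o_4 = s * w4 & W 'o_1 'o_5 = s ^+ 2 * w5],
      [/\ W 'o_2 'o_3 = w3, W 'o_2 'o_4 = s ^+ 2 * w4 & W 'o_2 'o_5 = s ^+ 4 * w5],
      [/\ W 'o_0 'o_1 = w3 + s * w4 + s ^+ 2 * w5,
          W 'o_0 'o_2 = w3 + s ^+ 2 * w4 + s ^+ 4 * w5 &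
          W 'o_1 'o_2 = w3 + s ^+ 3 * w4 + s ^+ 6 * w5] &
      [/\ W 'o_0 'o_1 *+ 2 = 0, W 'o_0 'o_2 *+ 2 = 0 & W 'o_1 'o_2 *+ 2 = 0]].
Proof.
have E0 j : _ := balanced j 'p_0; have E1 j : _ := balanced j 'p_1.
have E2 j : _ := balanced j 'p_2.
have c0 i j : vertex L i j 'p_0 = L i 'p_1 * L j 'p_2 - L i 'p_2 * L j 'p_1.
  by case: (crossE (L i) (L j)).
have c1 i j : vertex L i j 'p_1 = L i 'p_2 * L j 'p_0 - L i 'p_0 * L j 'p_2.
  by case: (crossE (L i) (L j)).
have c2 i j : vertex L i j 'p_2 = L i 'p_0 * L j 'p_1 - L i 'p_1 * L j 'p_0.
  by case: (crossE (L i) (L j)).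
have [e30 e31 e32] := And3 (E0 'o_3) (E1 'o_3) (E2 'o_3).
have [e41 e42 e51] := And3 (E1 'o_4) (E2 'o_4) (E1 'o_5).
have [e52 e01 e02] := And3 (E2 'o_5) (E1 'o_0) (E2 'o_0).
have [e10 e12 e20] := And3 (E0 'o_1) (E2 'o_1) (E0 'o_2).
have e21 := E1 'o_2.
rewrite !big6E ?c0 ?c1 ?c2 /lines6 /= ?W34 ?W35 ?W45 in
  e30 e31 e32 e41 e42 e51 e52 e01 e02 e10 e12 e20 e21.
have W13 : W 'o_1 'o_3 = w3 by apply: (eq_of_relation (c := -1) e32); ring.
have W14 : W 'o_1 'o_4 = s * w4 by apply: (eq_of_relation (c := -1) e42); ring.
have W15 : W 'o_1 'o_5 = s ^+ 2 * w5 by apply: (eq_of_relation (c := -1) e52); ring.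
have W23 : W 'o_2 'o_3 = w3 by apply: (eq_of_relation (c := 1) e31); ring.
have W24 : W 'o_2 'o_4 = s ^+ 2 * w4 by apply: (eq_of_relation (c := 1) e41); ring.
have W25 : W 'o_2 'o_5 = s ^+ 4 * w5 by apply: (eq_of_relation (c := 1) e51); ring.
rewrite W13 W14 W15 in e10 e12; rewrite W23 W24 W25 in e20 e21.
have W01 : W 'o_0 'o_1 = w3 + s * w4 + s ^+ 2 * w5.
  by apply: (eq_of_relation (c := 1) e12); ring.
have W02 : W 'o_0 'o_2 = w3 + s ^+ 2 * w4 + s ^+ 4 * w5.
  by apply: (eq_of_relation (c := -1) e21); ring.
have W12 : W 'o_1 'o_2 = w3 + s ^+ 3 * w4 + s ^+ 6 * w5.
  by apply: (eq_of_relation (c := 1) e20); ring.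
split=> //; split.
- by rewrite W01 in e02 *; apply: (eq_of_relation (c := 1) e02); ring.
- by rewrite W02 in e01 *; apply: (eq_of_relation (c := -1) e01); ring.
by rewrite W12 in e10 *; apply: (eq_of_relation (c := 1) e10); ring.
Qed.

Lemma stress_eq0_of_w : w3 = 0 -> w4 = 0 -> w5 = 0 ->
  forall i j : 'I_6, (i < j)%N -> W i j = 0.
Proof.
move=> z3 z4 z5; case: stress_relations; rewrite z3 z4 z5 !mulr0 !addr0.
move=> [W13 W14 W15] [W23 W24 W25] [W01 W02 W12] _.
move=> i j; case: i j => -[|[|[|[|[|[|?]]]]]] // li [[|[|[|[|[|[|?]]]]]] // lj] // _;
  by rewrite (bool_irrelevance li isT) (bool_irrelevance lj isT).
Qed.

(** Once the triangle weights vanish, their expressions form a Vandermonde system for the free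
    weights with distinct nodes [s], [s^2], [s^3]. *)
Lemma stress_eq0_char_neq2 : 2%:R != 0 :> k -> s != 0 -> s ^+ 4 != 1 ->
  forall i j : 'I_6, (i < j)%N -> W i j = 0.
Proof.
move=> two s0 s4; have [n1 n2 n3] := sub1_neq0 s4.
have half x : x *+ 2 = 0 -> x = 0 :> k.
  by move/eqP; rewrite -mulr_natr mulf_eq0 (negPf two) orbF => /eqP.
case: stress_relations => _ _ [W01 W02 W12] [/half z1 /half z2 /half z3].
rewrite z1 in W01; rewrite z2 in W02; rewrite z3 in W12.
have nz x y : x * y = 0 -> x != 0 -> y = 0 :> k.
  by move=> /eqP; rewrite mulf_eq0 => /orP [->|/eqP].
have z5 : w5 = 0.
  apply: (nz (s ^+ 3 * (s - 1) ^+ 2 * (s + 1))); last by rewrite !mulf_neq0 ?expf_neq0.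
  (* This combination eliminates [w3] and [w4]. *)
  transitivity (s * (w3 + s * w4 + s ^+ 2 * w5) - (1 + s) * (w3 + s ^+ 2 * w4 + s ^+ 4 * w5)
    + (w3 + s ^+ 3 * w4 + s ^+ 6 * w5)); first by ring.
  by rewrite -W01 -W02 -W12; ring.
have z4 : w4 = 0.
  apply: (nz (s * (s - 1))); last by rewrite !mulf_neq0.
  transitivity (w3 + s ^+ 2 * w4 + s ^+ 4 * w5 - (w3 + s * w4 + s ^+ 2 * w5)).
    by rewrite z5; ring.
  by rewrite -W01 -W02 subrr.
by apply: stress_eq0_of_w => //; rewrite [RHS]W01 z4 z5; ring.
Qed.

End Stresses.

Lemma S3E (R : comNzRingType) (A : 'I_6 -> R) :
  S3 A = A 'o_0 * A 'o_1 * A 'o_2 +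
    A 'o_0 * A 'o_1 * A 'o_3 +
    A 'o_0 * A 'o_1 * A 'o_4 +
    A 'o_0 * A 'o_1 * A 'o_5 +
    A 'o_0 * A 'o_2 * A 'o_3 +
    A 'o_0 * A 'o_2 * A 'o_4 +
    A 'o_0 * A 'o_2 * A 'o_5 +
    A 'o_0 * A 'o_3 * A 'o_4 +
    A 'o_0 * A 'o_3 * A 'o_5 +
    A 'o_0 * A 'o_4 * A 'o_5 +
    A 'o_1 * A 'o_2 * A 'o_3 +
    A 'o_1 * A 'o_2 * A 'o_4 +
    A 'o_1 * A 'o_2 * A 'o_5 +
    A 'o_1 * A 'o_3 * A 'o_4 +
    A 'o_1 * A 'o_3 * A 'o_5 +
    A 'o_1 * A 'o_4 * A 'o_5 +
    A 'o_2 * A 'o_3 * A 'o_4 +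
    A 'o_2 * A 'o_3 * A 'o_5 +
    A 'o_2 * A 'o_4 * A 'o_5 +
    A 'o_3 * A 'o_4 * A 'o_5.
Proof. by rewrite /S3 !big6E /=; ring. Qed.

(** * Balanced weights in characteristic 2 *)

Section CharacteristicTwo.
Variables (k : closedFieldType) (s : k) (Z : 'I_6 -> 'I_6 -> k).
Local Notation L := (lines6 s).
Hypothesis two : 2%:R = 0 :> k.
Hypothesis s3 : s ^+ 3 = s + 1.

(** One functional is tested twice: with weight [Z] at a vertex, moving single lines sees [Z] times
    [pi], and translating all lines sees [Z] times [e3]. *)
Let pi (i j : 'I_6) := \prod_(r | (r != i) && (r != j)) dot3 (L r) (vertex L i j).
Let e3 (i j : 'I_6) := S3 (fun l => dot3 (L l) (vertex L i j)).
Let W (i j : 'I_6) := Z i j * pi i j.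

Hypothesis balanced : forall (j : 'I_6) r,
  \sum_(l < 6 | (j < l)%N) W j l * vertex L j l r +
  \sum_(i < 6 | (i < j)%N) W i j * vertex L i j r = 0.
Hypothesis Z34 : Z 'o_3 'o_4 = 0.
Hypothesis Z35 : Z 'o_3 'o_5 = 0.
Hypothesis Z45 : Z 'o_4 'o_5 = 0.
Hypothesis second_order : forall r,
  \sum_(i < 6) \sum_(j < 6 | (i < j)%N) Z i j * vertex L i j r ^+ 2 * e3 i j = 0.

(* [s] generates the field with eight elements, so that every scalar below is [0] or a
   power of [s]; the polynomials [c1] and [c2] are the quotients in the reductions
   modulo [2] and [s ^ 3 - s - 1]. *)
Lemma gf8 (c1 c2 x y : k) : x = y + 2%:R * c1 + (s ^+ 3 - s - 1) * c2 -> x = y.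
Proof.
by rewrite two s3 mul0r addr0 => ->; rewrite (_ : s + 1 - s - 1 = 0) ?mul0r ?addr0 //; ring.
Qed.

(** Here [s^4 = s^2 + s], so [s^4 = 1] would give [s^2 + s + 1 = 0]; multiplied by [1 - s] this
    reads [1 - s^3 = 0], that is [s = 0]. *)
Lemma gf8_neq0 : s != 0 /\ s ^+ 4 != 1.
Proof.
have s0 : s != 0.
  by apply/eqP => h; move: s3; rewrite h expr0n add0r => /esym/eqP; rewrite oner_eq0.
split=> //; apply/eqP => h; have e1 : s ^+ 2 + s + 1 = 0.
  rewrite -[RHS](subrr (s ^+ 4)) {2}h; apply: (gf8 (c1 := 1) (c2 := - s)); ring.
case/eqP: s0; rewrite -[RHS](mulr0 (1 - s)) -e1; apply: (gf8 (c1 := s) (c2 := 1)); ring.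
Qed.

(** Balance leaves [w3], [w4], [w5] free, and the second order relations are three independent
    linear equations for them. The values of [pi] and [e3] at the vertices are tabulated first. *)
Lemma stress_eq0_char2 : forall i j : 'I_6, (i < j)%N -> W i j = 0.
Proof.
pose simp01 := (mul0r, mulr0, mul1r, mulr1, add0r, addr0, subr0, sub0r).
have pi01 : pi 'o_0 'o_1 = s ^+ 6.
  apply: (gf8 (c1 := 0) (c2 := 0)).
  rewrite /pi big6E /vertex !dot3_crossE /lines6 /= !simp01; ring.
have pi02 : pi 'o_0 'o_2 = s ^+ 3.
  apply: (gf8 (c1 := 0) (c2 := 0)).
  rewrite /pi big6E /vertex !dot3_crossE /lines6 /= !simp01; ring.
have pi03 : pi 'o_0 'o_3 = s ^+ 5.
  apply: (gf8 (c1 := - 1 - s) (c2 := - 2 - s ^+ 3)).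
  rewrite /pi big6E /vertex !dot3_crossE /lines6 /= !simp01; ring.
have pi04 : pi 'o_0 'o_4 = s ^+ 0.
  apply: (gf8 (c1 := 0) (c2 := 1 - s + s ^+ 2 - s ^+ 4 + 2 * s ^+ 5 - 2 * s ^+ 6 + s ^+ 7)).
  rewrite /pi big6E /vertex !dot3_crossE /lines6 /= !simp01; ring.
have pi05 : pi 'o_0 'o_5 = s ^+ 0.
  apply: (gf8 (c1 := - 1 - s - s ^+ 2) (c2 := - 1 - s - s ^+ 2 - s ^+ 4 - s ^+ 7 + s ^+ 8
    - s ^+ 9 + s ^+ 11 - s ^+ 12)).
  rewrite /pi big6E /vertex !dot3_crossE /lines6 /= !simp01; ring.
have pi12 : pi 'o_1 'o_2 = s ^+ 0.
  apply: (gf8 (c1 := 0) (c2 := 0)).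
  rewrite /pi big6E /vertex !dot3_crossE /lines6 /= !simp01; ring.
have pi13 : pi 'o_1 'o_3 = s ^+ 4.
  apply: (gf8 (c1 := - 1 - s) (c2 := - 1 - s - s ^+ 3)).
  rewrite /pi big6E /vertex !dot3_crossE /lines6 /= !simp01; ring.
have pi14 : pi 'o_1 'o_4 = s ^+ 2.
  apply: (gf8 (c1 := 0) (c2 := s ^+ 2 - s ^+ 3 + s ^+ 5)).
  rewrite /pi big6E /vertex !dot3_crossE /lines6 /= !simp01; ring.
have pi15 : pi 'o_1 'o_5 = s ^+ 3.
  apply: (gf8 (c1 := - 1 - 2 * s - s ^+ 2) (c2 := - 2 - 2 * s - s ^+ 3 - s ^+ 4 + s ^+ 5
    - s ^+ 6 - s ^+ 9)).
  rewrite /pi big6E /vertex !dot3_crossE /lines6 /= !simp01; ring.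
have pi23 : pi 'o_2 'o_3 = s ^+ 2.
  apply: (gf8 (c1 := - 1) (c2 := - 1)).
  rewrite /pi big6E /vertex !dot3_crossE /lines6 /= !simp01; ring.
have pi24 : pi 'o_2 'o_4 = s ^+ 1.
  apply: (gf8 (c1 := - 1 - s + s ^+ 2) (c2 := - 2 + s)).
  rewrite /pi big6E /vertex !dot3_crossE /lines6 /= !simp01; ring.
have pi25 : pi 'o_2 'o_5 = s ^+ 5.
  apply: (gf8 (c1 := - 1 - s) (c2 := - 2 - s ^+ 3)).
  rewrite /pi big6E /vertex !dot3_crossE /lines6 /= !simp01; ring.
have e01 : e3 'o_0 'o_1 = s ^+ 1.
  apply: (gf8 (c1 := 1 + 2 * s + 2 * s ^+ 2) (c2 := 2 + 3 * s + 2 * s ^+ 3)).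
  rewrite /e3 S3E /vertex dot3_crossl dot3_crossr !simp01 !dot3_crossE /lines6 /= !simp01; ring.
have e02 : e3 'o_0 'o_2 = s ^+ 4.
  apply: (gf8 (c1 := - 1 - 2 * s - s ^+ 2) (c2 := - 2 - s)).
  rewrite /e3 S3E /vertex dot3_crossl dot3_crossr !simp01 !dot3_crossE /lines6 /= !simp01; ring.
have e03 : e3 'o_0 'o_3 = s ^+ 2.
  apply: (gf8 (c1 := - s ^+ 2) (c2 := - s)).
  rewrite /e3 S3E /vertex dot3_crossl dot3_crossr !simp01 !dot3_crossE /lines6 /= !simp01; ring.
have e04 : e3 'o_0 'o_4 = 0.
  apply: (gf8 (c1 := - 1 - s + s ^+ 2) (c2 := - 2 + 2 * s ^+ 2 - 4 * s ^+ 3 + 5 * s ^+ 4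
    - 4 * s ^+ 5 + s ^+ 6)).
  rewrite /e3 S3E /vertex dot3_crossl dot3_crossr !simp01 !dot3_crossE /lines6 /= !simp01; ring.
have e05 : e3 'o_0 'o_5 = 0.
  apply: (gf8 (c1 := 1 + 2 * s + s ^+ 2) (c2 := 2 + 2 * s + 2 * s ^+ 3 + 2 * s ^+ 6
    - 2 * s ^+ 7 + 2 * s ^+ 8 + s ^+ 9 - s ^+ 10)).
  rewrite /e3 S3E /vertex dot3_crossl dot3_crossr !simp01 !dot3_crossE /lines6 /= !simp01; ring.
have e12 : e3 'o_1 'o_2 = 0.
  apply: (gf8 (c1 := 2) (c2 := 0)).
  rewrite /e3 S3E /vertex dot3_crossl dot3_crossr !simp01 !dot3_crossE /lines6 /= !simp01; ring.
have e13 : e3 'o_1 'o_3 = s ^+ 1.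
  apply: (gf8 (c1 := - 1 + s ^+ 2) (c2 := s)).
  rewrite /e3 S3E /vertex dot3_crossl dot3_crossr !simp01 !dot3_crossE /lines6 /= !simp01; ring.
have e14 : e3 'o_1 'o_4 = s ^+ 2.
  apply: (gf8 (c1 := 1 - s ^+ 2) (c2 := 2 - 2 * s - s ^+ 2 + 3 * s ^+ 3 - s ^+ 5)).
  rewrite /e3 S3E /vertex dot3_crossl dot3_crossr !simp01 !dot3_crossE /lines6 /= !simp01; ring.
have e15 : e3 'o_1 'o_5 = s ^+ 6.
  apply: (gf8 (c1 := - 2 - s - s ^+ 2) (c2 := - 4 + 2 * s - 3 * s ^+ 2 - s ^+ 3 + s ^+ 4
    - 4 * s ^+ 5 + s ^+ 6 + s ^+ 9)).
  rewrite /e3 S3E /vertex dot3_crossl dot3_crossr !simp01 !dot3_crossE /lines6 /= !simp01; ring.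
have e23 : e3 'o_2 'o_3 = s ^+ 4.
  apply: (gf8 (c1 := 1 - s - s ^+ 2) (c2 := - s)).
  rewrite /e3 S3E /vertex dot3_crossl dot3_crossr !simp01 !dot3_crossE /lines6 /= !simp01; ring.
have e24 : e3 'o_2 'o_4 = s ^+ 1.
  apply: (gf8 (c1 := - 2 - 3 * s + 3 * s ^+ 2) (c2 := - 4 + s)).
  rewrite /e3 S3E /vertex dot3_crossl dot3_crossr !simp01 !dot3_crossE /lines6 /= !simp01; ring.
have e25 : e3 'o_2 'o_5 = s ^+ 3.
  apply: (gf8 (c1 := - 2 + s ^+ 2) (c2 := - 4 + 3 * s + s ^+ 2 - s ^+ 3)).
  rewrite /e3 S3E /vertex dot3_crossl dot3_crossr !simp01 !dot3_crossE /lines6 /= !simp01; ring.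
(* Powers of [s] are thus inverted by powers of [s], which expresses [Z] by [W]. *)
have s7 : s ^+ 7 = 1 by apply: (gf8 (c1 := s ^+ 2 + s) (c2 := s ^+ 4 + s ^+ 2 + s + 1)); ring.
have ZW i j n n' : pi i j = s ^+ n' -> (n + n' = 7)%N -> Z i j = s ^+ n * W i j.
  by move=> pE nn; rewrite /W pE mulrCA -exprD nn s7 mulr1.
have [||| [W13 W14 W15] [W23 W24 W25] [W01 W02 W12] _] := stress_relations balanced.
- by rewrite /W Z34 mul0r.
- by rewrite /W Z35 mul0r.
- by rewrite /W Z45 mul0r.
have w_eq0 := stress_eq0_of_w balanced.
have z01 := ZW _ _ 1%N _ pi01 erefl.
have z02 := ZW _ _ 4%N _ pi02 erefl.
have z03 := ZW _ _ 2%N _ pi03 erefl.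
have z04 := ZW _ _ 7%N _ pi04 erefl.
have z05 := ZW _ _ 7%N _ pi05 erefl.
have z12 := ZW _ _ 7%N _ pi12 erefl.
have z13 := ZW _ _ 3%N _ pi13 erefl.
have z14 := ZW _ _ 5%N _ pi14 erefl.
have z15 := ZW _ _ 4%N _ pi15 erefl.
have z23 := ZW _ _ 5%N _ pi23 erefl.
have z24 := ZW _ _ 6%N _ pi24 erefl.
have z25 := ZW _ _ 2%N _ pi25 erefl.
rewrite W01 W02 W12 in z01 z02 z12.
rewrite ?W13 ?W14 ?W15 ?W23 ?W24 ?W25 in z13 z14 z15 z23 z24 z25.
move: (second_order 'p_0) (second_order 'p_1) (second_order 'p_2).
rewrite !big6E /vertex /= e01 e02 e03 e04 e05 e12 e13 e14 e15 e23 e24 e25 Z34 Z35 Z45.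
rewrite z01 z02 z03 z04 z05 z12 z13 z14 z15 z23 z24 z25.
move: (W 'o_0 'o_3) (W 'o_0 'o_4) (W 'o_0 'o_5) w_eq0 => w3 w4 w5 w_eq0.
have c0 i j : cross (L i) (L j) 'p_0 = L i 'p_1 * L j 'p_2 - L i 'p_2 * L j 'p_1.
  by case: (crossE (L i) (L j)).
have c1 i j : cross (L i) (L j) 'p_1 = L i 'p_2 * L j 'p_0 - L i 'p_0 * L j 'p_2.
  by case: (crossE (L i) (L j)).
have c2 i j : cross (L i) (L j) 'p_2 = L i 'p_0 * L j 'p_1 - L i 'p_1 * L j 'p_0.
  by case: (crossE (L i) (L j)).
rewrite !c0 !c1 !c2 /lines6 /= => f0 f1 f2.
have g0 : s * w3 + w4 = 0.
  rewrite -[RHS]f0; apply: (gf8 (c1 := (- 1 - 2 * s - 2 * s ^+ 2) * w3 + (- 4 - 8 * s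
    - 6 * s ^+ 2) * w4 + (- 28 - 49 * s - 37 * s ^+ 2) * w5)
    (c2 := (- 2 - 3 * s - s ^+ 2 - s ^+ 3 - s ^+ 4 - s ^+ 6) * w3 + (- 9 - 7 * s
      - 5 * s ^+ 2 - 4 * s ^+ 3 - 3 * s ^+ 4 - 2 * s ^+ 5 - 2 * s ^+ 6 - s ^+ 7 - s ^+ 8
      - s ^+ 9) * w4 + (- 56 - 42 * s - 32 * s ^+ 2 - 24 * s ^+ 3 - 18 * s ^+ 4
      - 14 * s ^+ 5 - 10 * s ^+ 6 - 8 * s ^+ 7 - 6 * s ^+ 8 - 4 * s ^+ 9 - 4 * s ^+ 10
      - 2 * s ^+ 11 - 2 * s ^+ 12 - s ^+ 13 - s ^+ 14 - s ^+ 15 - s ^+ 17) * w5)); ring.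
have g1 : s ^+ 5 * w4 + s ^+ 3 * w5 = 0.
  rewrite -[RHS]f1; apply: (gf8 (c1 := (- 2 - 4 * s - 3 * s ^+ 2) * w3 + (- 2 - 4 * s
    - 3 * s ^+ 2) * w4 + (- 3 - 6 * s - 5 * s ^+ 2) * w5)
    (c2 := (- 4 - 4 * s - 2 * s ^+ 2 - 2 * s ^+ 3 - s ^+ 4 - s ^+ 5 - s ^+ 6) * w3 + (- 4
      - 4 * s - 2 * s ^+ 2 - 2 * s ^+ 3 - 2 * s ^+ 4 - s ^+ 5 - s ^+ 6 - s ^+ 7) * w4 + (- 6
      - 6 * s - 4 * s ^+ 2 - 3 * s ^+ 3 - 3 * s ^+ 4 - s ^+ 5 - 2 * s ^+ 6 - s ^+ 7
      - s ^+ 9) * w5)); ring.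
have g2 : s ^+ 2 * w3 + w4 + w5 = 0.
  rewrite -[RHS]f2; apply: (gf8 (c1 := (- s - s ^+ 2) * w3 + (- 1 - 2 * s - s ^+ 2) * w4
    + (- 2 - 5 * s - 4 * s ^+ 2) * w5)
    (c2 := (- 2 * s) * w3 + (- 3 - s - s ^+ 2 - s ^+ 3 - s ^+ 5) * w4 + (- 5 - 5 * s
      - 3 * s ^+ 2 - 2 * s ^+ 3 - 2 * s ^+ 4 - s ^+ 5 - s ^+ 6 - s ^+ 7
      - s ^+ 9) * w5)); ring.
have [s0 _] := gf8_neq0.
(* In [g1 - s^3 g2 + (s^3 - s^5) g0] the terms in [w4] and [w5] cancel and [s^2 w3] remains. *)
have w30 : w3 = 0.
  have /eqP : s ^+ 2 * w3 = 0.
    rewrite -[RHS](mulr0 1) -{1}g1 -[RHS]addr0 -[X in _ = _ + X](mulr0 (- s ^+ 3)) -{1}g2.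
    rewrite -[RHS]addr0 -[X in _ = _ + X](mulr0 (s ^+ 3 - s ^+ 5)) -{1}g0.
    apply: (gf8 (c1 := (1 + s + s ^+ 2) * w3) (c2 := (2 + s ^+ 2 + s ^+ 3) * w3)); ring.
  by rewrite mulf_eq0 expf_eq0 (negPf s0) /= => /eqP.
have w40 : w4 = 0 by rewrite -g0 w30; ring.
have w50 : w5 = 0 by rewrite -g2 w30 w40; ring.
by apply: w_eq0 => //; rewrite /W ?Z34 ?Z35 ?Z45 mul0r.
Qed.

End CharacteristicTwo.

(** * The lower bound *)

(** Passing to the quotient by [v0] lowers the rank by at most one, and rows independent there stay
    independent together with [v0]. *)
Lemma pick_rows (F : fieldType) K N m (v0 : 'rV[F]_N) (A : 'M[F]_(K, N)) :
  v0 != 0 -> (m.+1 <= \rank A)%N ->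
  exists sel : 'I_m -> 'I_K, row_free (col_mx v0 (rowsub sel A)).
Proof.
move=> v0n rkA; pose Q := A *m cokermx v0.
have rkQ : (m <= \rank Q)%N.
  have := mxrank_mul_ker A (cokermx v0).
  have : (\rank (A :&: kermx (cokermx v0)) <= 1)%N.
    apply: leq_trans (rank_leq_row v0); apply: mxrankS.
    by rewrite submxE; apply/eqP/sub_kermxP; apply: capmxSr.
  by rewrite -/Q; lia.
pose sel (a : 'I_m) := maxrankfun Q (widen_ord rkQ a).
exists sel; apply: inj_row_free => u; rewrite -[u]hsubmxK mul_row_col => u0.
have y0 : rsubmx u = 0.
  have /(congr1 (mulmx^~ (cokermx v0))) := u0.
  rewrite mulmxDl -!mulmxA mulmx_coker mulmx0 add0r mul0mx mul_rowsub_mx -/Q => yQ.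
  pose y := \row_i \sum_(a | widen_ord rkQ a == i) rsubmx u 0 a.
  have : y *m rowsub (maxrankfun Q) Q = 0 *m rowsub (maxrankfun Q) Q.
    rewrite mul0mx -yQ !mulmx_sum_row; under eq_bigr => i _ do rewrite mxE scaler_suml.
    rewrite (exchange_big_dep predT) //=; apply: eq_bigr => a _.
    rewrite (big_pred1 (widen_ord rkQ a)) => [|i]; last by rewrite /= eq_sym.
    by congr (_ *: _); apply/rowP => j; rewrite !mxE.
  move/(row_free_inj (maxrowsub_free Q)) => /rowP y0; apply/rowP => a.
  have := y0 (widen_ord rkQ a); rewrite !mxE (big_pred1 a) ?mxE // => b.
move: u0; rewrite y0 mul0mx addr0 => /eqP x0.
suff -> : lsubmx u = 0 by rewrite row_mx0.
apply/rowP => i; rewrite ord1 [RHS]mxE; apply/eqP; move: x0.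
rewrite [lsubmx u]mx11_scalar mul_scalar_mx scaler_eq0 (negPf v0n) orbF.
by rewrite !mxE.
Qed.

Lemma S1_eq0 (R : comNzRingType) (A c : 'I_6 -> R) : (forall i, c i = 0) -> S1 A c = 0.
Proof. by move=> c0; rewrite /S1 big1 // => i _; rewrite c0 mul0r. Qed.

Lemma S2_eq0 (R : comNzRingType) (A b : 'I_6 -> R) : (forall i, b i = 0) -> S2 A b = 0.
Proof. by move=> b0; rewrite /S2 big1 // => i _; rewrite b0 mul0r. Qed.

(** Only the product omitting both zero factors survives. At a vertex, only moves of the two lines
    through it therefore count, which is the source of the balance condition. *)
Lemma S2_two_zeros (R : comNzRingType) (A b : 'I_6 -> R) i j :
  i != j -> A i = 0 -> A j = 0 ->
  S2 A b = (b i + b j) * \prod_(r | (r != i) && (r != j)) A r.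
Proof.
move=> ij Ai Aj.
have z l m : ~~ [&& i \in [:: l; m] & j \in [:: l; m]] ->
    \prod_(r | (r != m) && (r != l)) A r = 0.
  rewrite !inE => h.
  have [r rP Ar] : exists2 r, (r != m) && (r != l) & A r = 0.
    have [ri|ri] := boolP ((i != m) && (i != l)); first by exists i.
    exists j => //; have ri' : (i == l) || (i == m) by move: ri; rewrite negb_and !negbK orbC.
    by move: h; rewrite ri' /= negb_or andbC.
  by rewrite (bigD1 r) //= Ar mul0r.
rewrite /S2 (bigD1 i) //= [X in _ + X](bigD1 j) /=; last by rewrite eq_sym.
rewrite [X in _ + (_ + X)]big1 => [|l /andP [li lj]]; last first.
  rewrite big1 ?mulr0 // => m _; apply: z; rewrite !inE ![_ == l]eq_sym.
  rewrite (negPf li) (negPf lj) /=; apply/negP => /andP [/eqP <- /eqP e].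
  by rewrite e eqxx in ij.
rewrite [X in b i * X](bigD1 j) /=; last by rewrite eq_sym.
rewrite [X in b i * (_ + X)]big1 => [|m /andP [mi mj]]; last first.
  by apply: z; rewrite !inE eqxx /= (eq_sym j) (negPf ij) (eq_sym j) (negPf mj).
rewrite [X in b j * X](bigD1 i) //= [X in b j * (_ + X)]big1 => [|m /andP [mj mi]]; last first.
  by apply: z; rewrite !inE (negPf ij) (eq_sym i) (negPf mi).
rewrite !addr0 mulrDl; congr (_ * _ + _).
by apply: eq_bigl => r; rewrite andbC.
Qed.

Lemma sum_incident (R : pzRingType) (F : 'I_6 -> 'I_6 -> R) (j : 'I_6) :
  \sum_(i < 6) \sum_(l < 6 | (i < l)%N) ((j == i)%:R + (j == l)%:R) * F i l =
  \sum_(l < 6 | (j < l)%N) F j l + \sum_(i < 6 | (i < j)%N) F i j.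
Proof.
under eq_bigr => i _ do under eq_bigr => l _ do rewrite mulrDl.
under eq_bigr => i _ do rewrite big_split.
rewrite big_split /=; congr (_ + _).
  rewrite (bigD1 j) //= [X in _ + X]big1 ?addr0 => [|i].
    by apply: eq_bigr => l _; rewrite eqxx mul1r.
  by rewrite eq_sym => /negPf ->; rewrite big1 // => l _; rewrite mul0r.
rewrite (exchange_big_dep xpredT) //= (bigD1 j) //= [X in _ + X]big1 ?addr0 => [|i].
  by apply: eq_bigr => l _; rewrite eqxx mul1r.
by rewrite eq_sym => /negPf ->; rewrite big1 // => l _; rewrite mul0r.
Qed.

Section FunctionalOf.
Variables (k : closedFieldType) (d : nat) (v : 'rV[k]_#|{: mon d}|).

Definition functional_of (p : {mpoly k[3]}) : k := (cvec d p *m v^T) 0 0.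

Lemma functional_of_scalar : scalar functional_of.
Proof.
by move=> c p q; rewrite /functional_of linearP mulmxDl -scalemxAl !mxE.
Qed.
HB.instance Definition _ :=
  GRing.isLinear.Build k {mpoly k[3]} k *%R functional_of functional_of_scalar.

End FunctionalOf.

(** * The span of the leading terms *)

Section DirectionRank.
Variables (k : closedFieldType) (e : nat).
Local Notation d := (e.+1 + 4)%N.
Local Notation N := #|{: mon d}|.
Local Notation M := #|{: mon e}|.
Local Notation Par := ('I_6 * 'I_M + 'I_6 * 'I_3 + 'I_3)%type.
Variables (s eps : k) (h : 'I_3 -> k).
Local Notation L := (lines6 s).
Local Notation A := (fun j => linf (L j)).

(** The three kinds of directions change a coefficient form by a monomial, one coordinate of one
    line, or all lines by [eps] times a variable; [ex_parameter] takes [eps = 0] outside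
    characteristic 2. *)
Definition dirC (x : Par) (i : 'I_6) : {mpoly k[3]} :=
  if x is inl (inl b) then (b.1 == i)%:R *: 'X_[mon_of b.2] else 0.
Definition dirB (x : Par) (i : 'I_6) (r : 'I_3) : k :=
  if x is inl (inr b) then (b.1 == i)%:R * (b.2 == r)%:R else 0.
Definition dirM (x : Par) (r : 'I_3) : k :=
  if x is inr r' then eps * (r' == r)%:R else 0.
Definition dform (x : Par) := expansion2 A (dirC x) (fun j => linf (dirB x j))
  (linf (dirM x)) (linf h ^+ e).

Lemma linf0 : linf (fun=> 0 : k) = 0.
Proof. by rewrite /linf big1 // => r _; rewrite scale0r. Qed.

Lemma linf_delta (c : k) r : linf (fun r' => c * (r == r')%:R) = c *: 'X_r.
Proof.
rewrite /linf (bigD1 r) //= eqxx mulr1 big1 ?addr0 // => t.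
by rewrite eq_sym => /negPf ->; rewrite mulr0 scale0r.
Qed.

Lemma dformC b : dform (inl (inl b)) = star_gen L b.
Proof.
rewrite /dform /expansion2 [linf (dirM _)]linf0 expr0n mulr0 mul0r addr0.
rewrite S2_eq0 //.
rewrite mulr0 addr0 /S1 (bigD1 b.1) //= eqxx scale1r [X in _ + X]big1 ?addr0 // => i.
by rewrite eq_sym => /negPf ->; rewrite scale0r mul0r.
Qed.

Lemma dformB b : dform (inl (inr b)) =
  linf h ^+ e * S2 A (fun i => (b.1 == i)%:R *: 'X_(b.2)).
Proof.
rewrite /dform /expansion2 [linf (dirM _)]linf0 expr0n mulr0 mul0r addr0.
by rewrite S1_eq0 // add0r; congr (_ * _); apply: eq_bigr => j _; rewrite [linf _]linf_delta.
Qed.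

Lemma dformM r : dform (inr r) = linf h ^+ e * (eps *: 'X_r) ^+ 2 * (3%:R * S3 A).
Proof.
rewrite /dform /expansion2 [linf (dirM _)]linf_delta.
by rewrite S1_eq0 // S2_eq0 => [|j]; rewrite ?mulr0 ?add0r //; apply: linf0.
Qed.

Lemma dhomog_dform x : dform x \is d.-homog.
Proof.
have hl j : linf (L j) \is 1.-homog by apply: dhomog_linf.
case: x => [[b|b]|r].
- by rewrite dformC; apply: dhomog_star_gen.
- rewrite dformB addSnnS; apply: dhomogM; first exact: dhomog_linfX.
  apply: dhomog_suml => j _; apply: (dhomogM (d := 1) (e := 4)).
    by apply: dhomogZ; rewrite dhomogX; apply/eqP/mdeg1.
  by apply: dhomog_suml => i ij; apply: (dhomog_prod_but2 L ij).
rewrite dformM (_ : d = e + 2 + 3)%N; last by lia.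
apply: dhomogM.
  apply: dhomogM; first exact: dhomog_linfX.
  apply: (dhomogMn (d := 1) 2); apply: dhomogZ.
  by rewrite dhomogX; apply/eqP/mdeg1.
rewrite mulr_natl; apply: rpredMn; do 3!apply: dhomog_suml => ? _.
by apply: (dhomogM (d := 2) (e := 1)) => //; apply: (dhomogM (d := 1) (e := 1)).
Qed.

Hypothesis s0 : s != 0.
Hypothesis s4 : s ^+ 4 != 1.
Hypothesis hq : forall q, dot3 h (pvertex L q) != 0.
Hypothesis chr : 2%:R != 0 :> k \/ [/\ 2%:R = 0 :> k, s ^+ 3 = s + 1 & eps = 1].

Let nc : no_concurrent L := no_concurrent_lines6 s0 s4.

(** Among the vertices it is nonzero only at the one on lines [i] and [j], so a functional killing
    it has no weight there. *)
Definition extra_form (i j : 'I_6) := linf h ^+ e.+1 * prod_but2 L i j.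

(** Coefficient directions span the ideal, so [lam] is a weighted sum of values at the vertices.
    Moves of single lines give the balance conditions, and in characteristic 2 the translations give
    the second order relations. *)
Lemma functional_killing_directions (lam : {scalar {mpoly k[3]}}) :
  (forall x, lam (dform x) = 0) ->
  lam (extra_form 'o_3 'o_4) = 0 -> lam (extra_form 'o_3 'o_5) = 0 ->
  lam (extra_form 'o_4 'o_5) = 0 ->
  forall p, p \is d.-homog -> lam p = 0.
Proof.
move=> lamD x34 x35 x45.
have [p /=|mu muP] := @functional_killing_star_ideal _ L e.+1 lam nc.
  move=> [g [hg ->]]; rewrite linear_sum big1 //= => i _.
  rewrite -(cvecK (hg i)) mulr_suml linear_sum big1 // => j _ /=.
  by rewrite -scalerAl linearZ -[_ * _]/(star_gen L (i, j)) -dformC lamD /= mulr0.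
pose mu' (i j : 'I_6) := oapp mu 0 (insub (i, j)).
have mu'E q : mu' (val q).1 (val q).2 = mu q by rewrite /mu' -surjective_pairing valK.
have lamE p : p \is d.-homog ->
    lam p = \sum_(i < 6) \sum_(j < 6 | (i < j)%N) mu' i j * p.@[vertex L i j].
  move=> hp; rewrite (muP p hp) -(sum_pair6 (fun i j => mu' i j * p.@[vertex L i j])).
  by apply: eq_bigr => q _; rewrite mu'E.
(* All directions that move lines carry the factor [h^e], which is absorbed into the weights. *)
pose Z i j := mu' i j * (linf h ^+ e).@[vertex L i j].
have hn (i j : 'I_6) : (i < j)%N -> (linf h).@[vertex L i j] != 0.
  by move=> ij; have := hq (exist _ (i, j) ij); rewrite meval_linf.
have extra0 (i j : 'I_6) : (i < j)%N -> lam (extra_form i j) = 0 -> Z i j = 0.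
  move=> ij; pose q : pair6 := exist _ (i, j) ij.
  rewrite -[extra_form i j]/(linf h ^+ e.+1 * pprod L q) muP; last exact: dhomog_linf_pprod.
  rewrite (bigD1 q) //= big1 => [|q' ne]; last by rewrite meval_linf_pprod ?mulr0.
  move/eqP; rewrite addr0 mulf_eq0 (negPf (meval_linf_pprod_neq0 _ nc _)) // orbF => /eqP m0.
  by rewrite /Z -[mu' i j]/(mu' (val q).1 (val q).2) mu'E m0 mul0r.
have evA (i j l : 'I_6) : (linf (L l)).@[vertex L i j] = dot3 (L l) (vertex L i j).
  exact: meval_linf.
pose W i j := Z i j * \prod_(r | (r != i) && (r != j)) dot3 (L r) (vertex L i j).
have balanced (j : 'I_6) r :
    \sum_(l < 6 | (j < l)%N) W j l * vertex L j l r +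
    \sum_(i < 6 | (i < j)%N) W i j * vertex L i j r = 0.
  have := lamD (inl (inr (j, r))); rewrite (lamE _ (dhomog_dform _)) dformB => lam0; rewrite -[RHS]lam0.
  apply: etrans (esym (sum_incident (fun i l => W i l * vertex L i l r) j)) _.
  apply: eq_bigr => i _; apply: eq_bigr => l il.
  have ne : i != l by rewrite -val_eqE /= ltn_eqF.
  rewrite mevalM rmorph_S2 (S2_two_zeros _ ne) /=.
  - rewrite !mevalZ mevalXU /W /Z (eq_bigr _ (fun m _ => evA i l m)).
    by ring.
  - by rewrite evA dot3_crossl.
  by rewrite evA dot3_crossr.
suff W0 (i j : 'I_6) : (i < j)%N -> W i j = 0.
  move=> p hp; rewrite lamE // big1 // => i _; rewrite big1 // => j ij.
  have pin : \prod_(r | (r != i) && (r != j)) dot3 (L r) (vertex L i j) != 0.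
    apply/prodf_neq0 => r /andP [ri rj]; apply: nc; rewrite 1?eq_sym //.
    by rewrite -val_eqE /= gtn_eqF.
  have /eqP := W0 i j ij; rewrite /W /Z rmorphXn /= !mulf_eq0 expf_eq0 (negPf pin).
  by rewrite (negPf (hn i j ij)) andbF !orbF => /eqP ->; rewrite mul0r.
have [Z34 Z35 Z45] := And3 (extra0 'o_3 'o_4 isT x34) (extra0 'o_3 'o_5 isT x35)
  (extra0 'o_4 'o_5 isT x45).
case: chr => [two|[two s3 eps1]] ij.
  by apply: stress_eq0_char_neq2 ij => //; rewrite /W ?Z34 ?Z35 ?Z45 mul0r.
apply: (stress_eq0_char2 two s3 balanced Z34 Z35 Z45) ij => r.
have := lamD (inr r); rewrite (lamE _ (dhomog_dform _)) dformM eps1 scale1r => lam0; rewrite -[RHS]lam0.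
apply: eq_bigr => i' _; apply: eq_bigr => j' _.
rewrite !mevalM rmorph_S3 rmorph_nat rmorphXn /= mevalXU.
have -> : 3%:R = 1 :> k by rewrite [3%:R](natrD _ 2 1) two add0r.
rewrite mul1r !mulrA /Z rmorphXn /=; congr (_ * _); apply: eq_bigr => a _; apply: eq_bigr => b _.
by apply: eq_bigr => c _; rewrite /= !evA.
Qed.

Definition dir_mx : 'M[k]_(#|{: Par}|, N) := \matrix_x cvec d (dform (enum_val x)).

(** A vector orthogonal to the directions and to the three extra forms defines a functional killing
    every form, so together these rows span the whole space. *)
Lemma rank_dir_mx : (N - 3 <= \rank dir_mx)%N.
Proof.
pose X : 'M[k]_(3, N) := \matrix_i cvec d (nth 0 [:: extra_form 'o_3 'o_4;
  extra_form 'o_3 'o_5; extra_form 'o_4 'o_5] i).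
have full : row_full (col_mx dir_mx X).
  rewrite /row_full -mxrank_tr; apply: inj_row_free => v v0.
  have w0 : col_mx dir_mx X *m v^T = 0.
    by rewrite -[LHS]trmxK trmx_mul trmxK v0 trmx0.
  move: w0; rewrite mul_col_mx -[X in _ = X]col_mx0 => /eq_col_mx [wD wX].
  have lam0 p : p \is d.-homog -> functional_of v p = 0.
    apply: functional_killing_directions.
    - move=> x; transitivity ((cvec d (dform x) *m v^T) 0 0); first by [].
      have /row_matrixP/(_ (enum_rank x)) := wD.
      by rewrite row_mul rowK enum_rankK row0 => ->; rewrite mxE.
    - transitivity ((cvec d (extra_form 'o_3 'o_4) *m v^T) 0 0); first by [].
      have /row_matrixP/(_ 'p_0) := wX.
      by rewrite row_mul rowK row0 /= => ->; rewrite mxE.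
    - transitivity ((cvec d (extra_form 'o_3 'o_5) *m v^T) 0 0); first by [].
      have /row_matrixP/(_ 'p_1) := wX.
      by rewrite row_mul rowK row0 /= => ->; rewrite mxE.
    transitivity ((cvec d (extra_form 'o_4 'o_5) *m v^T) 0 0); first by [].
      have /row_matrixP/(_ 'p_2) := wX.
    by rewrite row_mul rowK row0 /= => ->; rewrite mxE.
  apply/rowP => j; rewrite [RHS]mxE -(lam0 _ (dhomog_form (delta_mx 0 j))).
  by rewrite /functional_of formK -rowE !mxE.
have : (\rank (dir_mx + X)%MS <= \rank dir_mx + \rank X)%N by apply: mxrank_adds_leqif.
by rewrite (addsmxE dir_mx X) (eqP full); have := rank_leq_row X; lia.
Qed.

End DirectionRank.

(** Outside characteristic 2 any [s] off finitely many values will do; in characteristic 2 a root of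
    [X^3 - X - 1] is taken. The condition [s^3 != 1] serves to make the base form nonzero. *)
Lemma ex_parameter (k : closedFieldType) : exists s eps : k,
  [/\ s != 0, s ^+ 4 != 1, s ^+ 3 != 1, eps *+ 2 = 0 &
      2%:R != 0 :> k \/ [/\ 2%:R = 0 :> k, s ^+ 3 = s + 1 & eps = 1]].
Proof.
have [two|two] := eqVneq (2%:R : k) 0; last first.
  have : 'X * ('X^4 - 1) * ('X^3 - 1) != 0 :> {poly k}.
    by rewrite !mulf_neq0 ?polyX_eq0 // -size_poly_eq0 size_XnsubC.
  case/closed_nonrootP => s; rewrite rootE !hornerE !mulf_eq0 !negb_or !subr_eq0.
  by move=> /andP [/andP [s0 s4] s3]; exists s, 0; split=> //; [rewrite mul0rn | left].
have size3 : size ('X^3 - 'X - 1%:P : {poly k}) = 4.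
  rewrite -addrA size_polyDl size_polyXn // -opprD size_polyN.
  by rewrite size_polyDl ?size_polyX // size_polyC oner_neq0.
have /closed_rootP [s] : size ('X^3 - 'X - 1%:P : {poly k}) != 1%N by rewrite size3.
rewrite rootE !hornerE => /eqP sE.
have s3 : s ^+ 3 = s + 1 by apply/eqP; rewrite -subr_eq0 opprD addrA; apply/eqP.
have [s0 s4] := gf8_neq0 two s3.
exists s, 1; split=> //; last by right.
by rewrite s3 -subr_eq0 addrK.
Qed.

Lemma base_form_neq0 (k : closedFieldType) e (s : k) h q : s != 0 -> s ^+ 4 != 1 ->
  s ^+ 3 != 1 -> dot3 h (pvertex (lines6 s) q) != 0 -> base_form e (lines6 s) h != 0.
Proof.
move=> s0 s4 s3 hq; have [n1 n2 _] := sub1_neq0 s4.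
rewrite /base_form mulf_neq0 ?expf_neq0 //.
  apply: contraNneq hq => h0.
  by rewrite -[X in X == 0]/(\sum_r h r * pvertex (lines6 s) q r) -meval_linf h0 meval0.
(* This point lies on the first line and on no other, so exactly one of the six products
   survives. *)
pose x (r : 'I_3) := nth 0 [:: 0; 1; - s] r.
apply/eqP => /(congr1 (meval x)); rewrite meval0 rmorph_S1 /S1 !big6E /= !meval_linf.
rewrite -!/(dot3 _ _) !dot3E /lines6 /x /= meval1 => S0.
have /eqP : s ^+ 4 * (s - 1) ^+ 2 * (s + 1) * (s ^+ 3 - 1) = 0 by rewrite -[RHS]S0; ring.
by apply/negP; rewrite !mulf_neq0 ?expf_neq0 // subr_eq0.
Qed.

Lemma has_chain_Sdl (k : closedFieldType) e :
  has_chain (zclosure (@Sdl k (e.+1 + 4) 6)) (#|{: mon (e.+1 + 4)}| - 4).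
Proof.
have [s [eps [s0 s4 s3 eps2 chr]]] := ex_parameter k.
have nc := no_concurrent_lines6 s0 s4.
have [h hq] := exists_line_off_vertices nc.
have q0 : pair6 by exists ('o_0, 'o_1).
have b0 : cvec (e.+1 + 4) (base_form e (lines6 s) h) != 0.
  have := base_form_neq0 e s0 s4 s3 (hq q0); apply: contraNneq => c0.
  have hb : base_form e (lines6 s) h \is (e.+1 + 4)%N.-homog.
    rewrite addSnnS; apply: dhomogM (dhomog_linfX _ _) _.
    by apply: (@dhomog_star_form _ _ 0) => i; apply: dhomog1.
  by rewrite -(cvecK hb) c0 linear0.
have rk := rank_dir_mx e s0 s4 hq chr.
have N21 := card_mon_ge21 e.
(* The rank exceeds the length of the chain by one, which allows for the dimension taken by the base
   form. *)
have rk' : ((#|{: mon (e.+1 + 4)}| - 4).+1 <= \rank (dir_mx e s eps h))%N.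
  by apply: leq_trans rk; lia.
have [sel freeS] := pick_rows b0 rk'.
pose x a := enum_val (sel a).
apply: (@chain_of_directions _ e (lines6 s) h _ (fun a => @dirC k e (x a))
  (fun a => @dirB k e (x a)) (fun a => @dirM k e eps (x a))) => //.
- move=> a i; case: (x a) => [[b|b]|r]; rewrite ?dhomog0 //= dhomogZ // dhomogX.
  exact/eqP/mdeg_mon_of.
- by move=> a r; case: (x a) => [[b|b]|r'] /=; rewrite ?mul0rn // -mulrnAl eps2 mul0r.
rewrite (_ : \matrix_a _ = rowsub sel (dir_mx e s eps h)) //.
by apply/matrixP => a j; rewrite !mxE.
Qed.

Theorem theorem3p1 (k : closedFieldType) (d : nat) :
  (5 <= d)%N -> pdim (@Sdl k d 6) ('C(d.+2, 2) - 4)%N.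
Proof.
move=> d5; have [e ->] : exists e, d = (e.+1 + 4)%N by exists (d - 5)%N; lia.
rewrite -card_mon; split; [exact: has_chain_Sdl | exact: no_chain_Sdl].
Qed.
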